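(* Let $R\subset F$ be an extension of real closed fields, let $M\subset R^n$ be a semialgebraic set, and let $\mathcal{S}^{\diamond}(M,R)$ denote either $\mathcal{S}(M,R)$ or $\mathcal{S}^*(M,R)$. Let $\varphi:\mathcal{S}^{\diamond}(M,R)\to F$ be an $R$-homomorphism, put $\mathfrak{p}:=\ker\varphi$, and let $(X,{\tt j})$, $X\subset R^m$, be a brimming semialgebraic pseudo-compactification of $M$ for $\mathfrak{p}$. Let ${\tt p}\in F^m$ be the core of $\psi:=\varphi\circ{\tt j}^*:\mathcal{S}(X,R)\to F$ and denote $A:=\mathcal{S}(X,R)/(\mathfrak{p}\cap\mathcal{S}(X,R))$. Then $\psi$ induces the (well-defined) homomorphism $$\widehat\psi:\mathrm{qf}(A)=\mathrm{qf}(\mathcal{S}^{\diamond}(M,R)/\mathfrak{p})\hookrightarrow F,\quad \frac{[a_1]}{[a_2]}\mapsto\frac{\psi(a_1)}{\psi(a_2)}=\frac{a_{1,F}({\tt p})}{a_{2,F}({\tt p})}\qquad(a_1,a_2\in\mathcal{S}(X,R),\ a_2\notin\mathfrak{p}\cap\mathcal{S}(X,R)),$$ and the resulting diagram is commutative: if $\overline{\varphi}:\mathcal{S}^{\diamond}(M,R)/\mathfrak{p}\hookrightarrow F$ is the homomorphism induced by $\varphi$ and $\overline{\tt j}^*:A\hookrightarrow\mathcal{S}^{\diamond}(M,R)/\mathfrak{p}$ the one induced by ${\tt j}^*$, then $\widehat\psi|_{\mathcal{S}^{\diamond}(M,R)/\mathfrak{p}}=\overline\varphi$, $\ \overline\varphi\circ\overline{\tt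 j}^*=\widehat\psi|_A$, and the compositions of $\overline\varphi$ and $\widehat\psi|_A$ with the canonical projections $\mathcal{S}^{\diamond}(M,R)\to\mathcal{S}^{\diamond}(M,R)/\mathfrak{p}$ and $\mathcal{S}(X,R)\to A$ are $\varphi$ and $\psi$, respectively. In particular, $\varphi$ is completely determined by ${\tt p}$: if $f\in\mathcal{S}^{\diamond}(M,R)$, there exist $a_1,a_2\in\mathcal{S}(X,R)$ such that $a_{2,F}({\tt p})\neq0$, $a_2f-a_1\in\mathfrak{p}$ and $\varphi(f)=\dfrac{a_{1,F}({\tt p})}{a_{2,F}({\tt p})}$.
   Context: For a semialgebraic set $M\subset R^n$, a semialgebraic function on $M$ is a continuous function $f:M\to R$ whose graph is semialgebraic; $\mathcal{S}(M,R)$ is the ring of all of them and $\mathcal{S}^*(M,R)$ the subring of bounded ones. $X_F\subset F^m$ denotes the extension to $F$ of a semialgebraic set $X\subset R^m$ (defined by the same first-order formula with parameters in $R$), and $a_F:X_F\to F$ the extension of $a\in\mathcal{S}(X,R)$. A semialgebraic pseudo-compactification of $M$ is a pair $(X,{\tt j})$ consisting of a closed and bounded semialgebraic set $X\subset R^m$ and a semialgebraic embedding (continuous semialgebraic map that is a homeomorphism onto its image) ${\tt j}:M\hookrightarrow X$ whose image is dense in $X$. It induces the injective $R$-homomorphism ${\tt j}^*:\mathcal{S}(X,R)\hookrightarrow\mathcal{S}^{\diamond}(M,R),\ a\mapsto a\circ{\tt j}$ (all functions in $\mathcal{S}(X,R)$ are bounded), through which $\mathcal{S}(X,R)$ is regarded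 as a subring of $\mathcal{S}^{\diamond}(M,R)$ (so $a_2f-a_1$ means ${\tt j}^*(a_2)f-{\tt j}^*(a_1)$); for an ideal $\mathfrak{a}$ of $\mathcal{S}^{\diamond}(M,R)$ one writes $\mathfrak{a}\cap\mathcal{S}(X,R):=({\tt j}^* )^{-1}(\mathfrak{a})$. $\mathrm{qf}$ denotes the field of fractions of an integral domain. For a prime ideal $\mathfrak{p}$ of $\mathcal{S}^{\diamond}(M,R)$, $(X,{\tt j})$ is a brimming semialgebraic pseudo-compactification of $M$ for $\mathfrak{p}$ if $\mathrm{qf}(\mathcal{S}(X,R)/(\mathfrak{p}\cap\mathcal{S}(X,R)))=\mathrm{qf}(\mathcal{S}^{\diamond}(M,R)/\mathfrak{p})$, i.e. the field inclusion induced by ${\tt j}^*$ is an equality (isomorphism). The core of an $R$-homomorphism $\psi:\mathcal{S}(X,R)\to F$, $X\subset R^m$, is the point $(\psi(\pi_1),\ldots,\psi(\pi_m))\in F^m$, where $\pi_i:X\to R$ is the $i$-th coordinate function; it lies in $X_F$, so that $a_F({\tt p})$ makes sense for $a\in\mathcal{S}(X,R)$. *)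

(* Defs.v *)
From HB Require Import structures.
From mathcomp Require Import all_boot all_order all_algebra.
From mathcomp Require Import generic_quotient fraction ring_quotient.
From mathcomp.real_closed Require Import polyrcf ordered_qelim qe_rcf.
From mathcomp Require Import boolp classical_sets functions.
From mathcomp Require Import topology normedtype.

Set Implicit Arguments.
Unset Strict Implicit.
Unset Printing Implicit Defensive.

Import Order.TTheory GRing.Theory Num.Theory.
Import numFieldNormedType.Exports.

Local Open Scope classical_set_scope.
Local Open Scope ring_scope.

Section SemialgebraicSets.
Variable R : rcfType.

(* Assigns the coordinates of x to the variables 'X_0, ..., 'X_(n-1); the
   remaining variables of a formula are evaluated at 0. *)
Definition env n (x : 'rV[R]_n) : seq R := [seq x 0 i | i <- enum 'I_n].

Definition sat n (f : ord.formula R) : set 'rV[R]_n :=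
  [set x | ord.holds (env x) f].

(* Boolean combinations of polynomial equalities and inequalities. *)
Definition sign_formula (f : ord.formula R) : bool :=
  ord.qf_form f && ord.rformula f.

Definition semialgebraic n (A : set 'rV[R]_n) : Prop :=
  exists2 f, sign_formula f & A = sat f.

End SemialgebraicSets.

Section Definability.
Variable R : rcfType.
Implicit Types (e s : seq R) (P Q : seq R -> Prop).

Lemma qe_formula (f : ord.formula R) : exists2 g, sign_formula g &
  forall e, ord.holds e g <-> ord.holds e f.
Proof.
pose g := ord.quantifier_elim (@wproj R) (ord.to_rform f).
have gwf : sign_formula g.
  exact: (ord.quantifier_elim_wf (@wf_QE_wproj R) (ord.to_rform_rformula f)).
exists g => // e; case/andP: gwf => qfg _.
split=> [/(ord.qf_evalP _ qfg)|fe].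
  move/(ord.quantifier_elim_rformP (@wf_QE_wproj R) (@valid_QE_wproj R) _
     (ord.to_rform_rformula f)).
  by move/ord.to_rformP.
apply/(ord.qf_evalP _ qfg).
apply/(ord.quantifier_elim_rformP (@wf_QE_wproj R) (@valid_QE_wproj R) _
     (ord.to_rform_rformula f)).
exact/ord.to_rformP.
Qed.

(* Substitution of the terms s for the variables; finst is meant for
   quantifier-free formulas only. *)
Fixpoint tinst (s : seq (GRing.term R)) (t : GRing.term R) : GRing.term R :=
  match t with
  | GRing.Var i => nth (GRing.NatConst R 0) s i
  | GRing.Const c => GRing.Const c
  | GRing.NatConst n => GRing.NatConst R n
  | GRing.Add t1 t2 => GRing.Add (tinst s t1) (tinst s t2)
  | GRing.Opp t1 => GRing.Opp (tinst s t1)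
  | GRing.NatMul t1 n => GRing.NatMul (tinst s t1) n
  | GRing.Mul t1 t2 => GRing.Mul (tinst s t1) (tinst s t2)
  | GRing.Inv t1 => GRing.Inv (tinst s t1)
  | GRing.Exp t1 n => GRing.Exp (tinst s t1) n
  end.

Fixpoint finst (s : seq (GRing.term R)) (f : ord.formula R) : ord.formula R :=
  match f with
  | ord.Bool b => ord.Bool b
  | ord.Equal t1 t2 => ord.Equal (tinst s t1) (tinst s t2)
  | ord.Lt t1 t2 => ord.Lt (tinst s t1) (tinst s t2)
  | ord.Le t1 t2 => ord.Le (tinst s t1) (tinst s t2)
  | ord.Unit t1 => ord.Unit (tinst s t1)
  | ord.And f1 f2 => ord.And (finst s f1) (finst s f2)
  | ord.Or f1 f2 => ord.Or (finst s f1) (finst s f2)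
  | ord.Implies f1 f2 => ord.Implies (finst s f1) (finst s f2)
  | ord.Not f1 => ord.Not (finst s f1)
  | ord.Exists i f1 => ord.Exists i f1
  | ord.Forall i f1 => ord.Forall i f1
  end.

Lemma eval_tinst e (s : seq (GRing.term R)) t :
  GRing.eval e (tinst s t) = GRing.eval (map (GRing.eval e) s) t.
Proof.
elim: t => //=; try by move=> *; congruence.
move=> i; case: (ltnP i (size s)) => h; first by rewrite (nth_map (GRing.NatConst R 0)).
by rewrite !nth_default ?size_map.
Qed.

Lemma holds_finst e (s : seq (GRing.term R)) f : ord.qf_form f ->
  (ord.holds e (finst s f) <-> ord.holds (map (GRing.eval e) s) f).
Proof.
elim: f => //=; try by move=> *; rewrite !eval_tinst.
- by move=> f1 h1 f2 h2 /andP[/h1 {}h1 /h2 {}h2]; tauto.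
- by move=> f1 h1 f2 h2 /andP[/h1 {}h1 /h2 {}h2]; tauto.
- by move=> f1 h1 f2 h2 /andP[/h1 {}h1 /h2 {}h2]; tauto.
- by move=> f1 h1 /h1 {}h1; tauto.
Qed.

Definition definable n P : Prop :=
  exists f, forall e, size e = n -> (ord.holds e f <-> P e).

Lemma def_ext n P Q : (forall e, size e = n -> (P e <-> Q e)) ->
  definable n P -> definable n Q.
Proof.
move=> PQ [f fP]; exists f => e se; have := fP e se; have := PQ e se; tauto.
Qed.

Lemma def_and n P Q : definable n P -> definable n Q ->
  definable n (fun e => P e /\ Q e).
Proof.
move=> [f fP] [g gQ]; exists (ord.And f g) => e se /=.
by have := fP e se; have := gQ e se; tauto.
Qed.

Lemma def_not n P : definable n P -> definable n (fun e => ~ P e).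
Proof.
by move=> [f fP]; exists (ord.Not f) => e se /=; have := fP e se; tauto.
Qed.

Lemma def_imp n P Q : definable n P -> definable n Q ->
  definable n (fun e => P e -> Q e).
Proof.
move=> [f fP] [g gQ]; exists (ord.Implies f g) => e se /=.
by have := fP e se; have := gQ e se; tauto.
Qed.

Lemma def_eq n t1 t2 : definable n (fun e => GRing.eval e t1 = GRing.eval e t2).
Proof. by exists (ord.Equal t1 t2). Qed.

Lemma def_lt n t1 t2 : definable n (fun e => GRing.eval e t1 < GRing.eval e t2).
Proof. by exists (ord.Lt t1 t2). Qed.

Lemma def_le n t1 t2 : definable n (fun e => GRing.eval e t1 <= GRing.eval e t2).
Proof. by exists (ord.Le t1 t2). Qed.

Lemma def_ex1 n P : definable n.+1 P ->
  definable n (fun e => exists x, P (rcons e x)).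
Proof.
move=> [f fP]; exists (ord.Exists n f) => e se /=.
have E x : set_nth 0 e n x = rcons e x.
  by rewrite -se; elim: (e) => //= y e' ->.
split=> -[x]; rewrite ?E => h; exists x; rewrite ?E;
  by move/fP: h; rewrite size_rcons se; apply.
Qed.

Lemma def_ex n m P : definable (n + m) P ->
  definable n (fun e => exists2 s, size s = m & P (e ++ s)).
Proof.
elim: m n P => [|m IH] n P dP.
  rewrite addn0 in dP; apply: def_ext dP => e se; split.
    by move=> Pe; exists [::]; rewrite ?cats0.
  by case=> -[] // _; rewrite cats0.
rewrite -addSnnS in dP; move: (def_ex1 (IH _ _ dP)); apply: def_ext => e se; split.
  by case=> x [s ss]; rewrite cat_rcons => h; exists (x :: s); rewrite //= ss.
by case=> -[|x s] //= [ss] h; exists x; exists s; rewrite ?cat_rcons.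
Qed.

Lemma def_all n m P : definable (n + m) P ->
  definable n (fun e => forall s, size s = m -> P (e ++ s)).
Proof.
move=> /def_not/def_ex/def_not; apply: def_ext => e se; split.
  by move=> h s ss; apply: contrapT => nP; apply: h; exists s.
by move=> h [s ss]; apply; apply: h.
Qed.

Lemma def_inst n k (s : seq (GRing.term R)) P : size s = k -> definable k P ->
  definable n (fun e => P (map (GRing.eval e) s)).
Proof.
move=> <- [f fP]; have [g /andP[qfg _] gf] := qe_formula f.
exists (finst s g) => e _.
have := holds_finst e s qfg; have := gf (map (GRing.eval e) s).
by have := fP (map (GRing.eval e) s); rewrite size_map; tauto.
Qed.

Lemma def_forall_seq (I : eqType) (r : seq I) n (P : I -> seq R -> Prop) :
  (forall i, definable n (P i)) ->
  definable n (fun e => forall i, i \in r -> P i e).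
Proof.
move=> dP; elim: r => [|j r IH].
  by exists (ord.Bool true) => e _; split.
apply: def_ext (def_and (dP j) IH) => e _; split.
  by case=> h1 h2 i; rewrite inE => /predU1P[->//|/h2].
by move=> h; split=> [|i ir]; apply: h; rewrite inE ?eqxx ?ir ?orbT.
Qed.

End Definability.

(* Definable subsets of R that are downward closed, nonempty and bounded above
   have a supremum. *)
Section OMinimality.
Variable R : rcfType.

Lemma eval_term1 (t : GRing.term R) : GRing.rterm t ->
  exists p : {poly R}, forall x, GRing.eval [:: x] t = p.[x].
Proof.
elim: t => //=.
- move=> [|i] _; first by exists 'X => x; rewrite hornerX.
  by exists 0 => x; rewrite horner0 nth_default.
- by move=> c _; exists c%:P => x; rewrite hornerC.
- by move=> n _; exists (n%:R)%:P => x; rewrite hornerC.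
- move=> t1 h1 t2 h2 /andP[/h1[p pE] /h2[q qE]].
  by exists (p + q) => x; rewrite hornerD pE qE.
- by move=> t1 h1 /h1[p pE]; exists (- p) => x; rewrite hornerN pE.
- by move=> t1 h1 n /h1[p pE]; exists (p *+ n) => x; rewrite hornerMn pE.
- move=> t1 h1 t2 h2 /andP[/h1[p pE] /h2[q qE]].
  by exists (p * q) => x; rewrite hornerM pE qE.
- by move=> t1 h1 n /h1[p pE]; exists (p ^+ n) => x; rewrite horner_exp pE.
Qed.

Definition breaks (s : seq R) (Q : R -> R -> Prop) : Prop :=
  forall u v, u < v -> (forall x, x \in s -> ~~ (u <= x <= v)) -> Q u v.

Lemma poly_breaks (p : {poly R}) :
  exists s, breaks s (fun u v => Num.sg p.[u] = Num.sg p.[v]).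
Proof.
have [->|p0] := eqVneq p 0; first by exists [::] => u v _ _; rewrite !horner0.
exists (rootsR p) => u v uv h.
apply: (@polyrN0_itv _ `[u, v]); rewrite ?bound_in_itv ?bnd_simp ?ltW //.
move=> x; rewrite in_itv /= => xuv; apply/negP => px.
suff /h : x \in rootsR p by rewrite xuv.
by rewrite -(roots_on_rootsR p0) in_itv.
Qed.

Lemma formula_breaks (f : ord.formula R) : sign_formula f ->
  exists s, breaks s (fun u v => ord.holds [:: u] f <-> ord.holds [:: v] f).
Proof.
rewrite /sign_formula; elim: f => //=.
- by move=> b _; exists [::].
- move=> t1 t2 /andP[/eval_term1[p pE] /eval_term1[q qE]].
  have [s sP] := poly_breaks (p - q); exists s => u v uv /(sP _ _ uv).
  rewrite !pE !qE !hornerE => E; rewrite !(rwP eqP) -!(subr_eq0 p.[_]).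
  by rewrite -sgr_eq0 E sgr_eq0.
- move=> t1 t2 /andP[/eval_term1[p pE] /eval_term1[q qE]].
  have [s sP] := poly_breaks (p - q); exists s => u v uv /(sP _ _ uv).
  rewrite !pE !qE !hornerE => E; rewrite -!(subr_lt0 q.[_]).
  by rewrite -sgr_lt0 E sgr_lt0.
- move=> t1 t2 /andP[/eval_term1[p pE] /eval_term1[q qE]].
  have [s sP] := poly_breaks (p - q); exists s => u v uv /(sP _ _ uv).
  rewrite !pE !qE !hornerE => E; rewrite -!(subr_le0 q.[_]).
  by rewrite -sgr_le0 E sgr_le0.
- move=> f1 h1 f2 h2 /andP[/andP[q1 q2] /andP[r1 r2]].
  have [|s1 s1P] := h1; first by rewrite q1.
  have [|s2 s2P] := h2; first by rewrite q2.
  exists (s1 ++ s2) => u v uv hs.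
  have E1 := s1P u v uv; have E2 := s2P u v uv.
  by rewrite E1 ?E2 // => x xs; apply: hs; rewrite mem_cat xs ?orbT.
- move=> f1 h1 f2 h2 /andP[/andP[q1 q2] /andP[r1 r2]].
  have [|s1 s1P] := h1; first by rewrite q1.
  have [|s2 s2P] := h2; first by rewrite q2.
  exists (s1 ++ s2) => u v uv hs.
  have E1 := s1P u v uv; have E2 := s2P u v uv.
  by rewrite E1 ?E2 // => x xs; apply: hs; rewrite mem_cat xs ?orbT.
- move=> f1 h1 f2 h2 /andP[/andP[q1 q2] /andP[r1 r2]].
  have [|s1 s1P] := h1; first by rewrite q1.
  have [|s2 s2P] := h2; first by rewrite q2.
  exists (s1 ++ s2) => u v uv hs.
  have E1 := s1P u v uv; have E2 := s2P u v uv.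
  by rewrite E1 ?E2 // => x xs; apply: hs; rewrite mem_cat xs ?orbT.
- move=> f1 h1 /h1[s sP]; exists s => u v uv /(sP _ _ uv); tauto.
Qed.

Lemma breaks_sup (S : R -> Prop) (s : seq R) (a b : R) :
  breaks s (fun u v => S u <-> S v) ->
  (forall x y, x <= y -> S y -> S x) -> S a -> ~ S b ->
  exists c, forall e, 0 < e -> S (c - e) /\ ~ S (c + e).
Proof.
move=> sP dS.
suff main (r : seq R) a' b' : (forall u v, a' < u -> u < v -> v < b' ->
    (forall x, x \in r -> ~~ (u <= x <= v)) -> (S u <-> S v)) ->
    S a' -> ~ S b' ->
    exists c, forall e, 0 < e -> S (c - e) /\ ~ S (c + e).
  by apply: (main s a b) => // u v _ uv _; apply: sP.
elim: r a' b' {sP} => [|r0 r IH] a' b' hr Sa Sb.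
  have ab : a' < b' by rewrite ltNge; apply/negP => ba; apply: Sb; apply: dS Sa.
  pose m := (a' + b') / 2.
  have [am mb] : a' < m /\ m < b' by split; rewrite ?midf_lt.
  have [Sm|Sm] := pselect (S m).
    exists b' => e e0; split; last first.
      by move=> Se; apply: Sb; apply: dS Se; rewrite lerDl ltW.
    have [bm|mbe] := leP (b' - e) m; first exact: dS Sm.
    by apply/(hr m (b' - e)) => //; rewrite gtrBl.
  exists a' => e e0; split; first by apply: dS Sa; rewrite gerBl ltW.
  have [ma|mae] := leP m (a' + e); first by move=> Se; apply: Sm; apply: dS Se.
  by move=> Se; apply: Sm; apply/(hr (a' + e) m) => //; rewrite ltrDl.
have [Sr|Sr] := pselect (S r0).
  have [ra|ar] := leP r0 a'.
    apply: (IH a' b') => // u v au uv vb h; apply: hr => // x.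
    rewrite inE => /predU1P[->|/h//]; apply/negP => /andP[ur _].
    by have := lt_le_trans au (le_trans ur ra); rewrite ltxx.
  apply: (IH r0 b') => // u v ru uv vb h; apply: hr => //.
    exact: lt_trans ru.
  move=> x; rewrite inE => /predU1P[->|/h//]; apply/negP => /andP[ur _].
  by have := lt_le_trans ru ur; rewrite ltxx.
have [br|rb] := leP b' r0.
  apply: (IH a' b') => // u v au uv vb h; apply: hr => // x.
  rewrite inE => /predU1P[->|/h//]; apply/negP => /andP[_ rv].
  by have := le_lt_trans (le_trans br rv) vb; rewrite ltxx.
apply: (IH a' r0) => // u v ru uv vb h; apply: hr => //.
  exact: lt_trans rb.
move=> x; rewrite inE => /predU1P[->|/h//]; apply/negP => /andP[_ rv].
by have := le_lt_trans rv vb; rewrite ltxx.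
Qed.

Lemma definable_sup (S : R -> Prop) (a b : R) :
  definable 1 (fun e : seq R => S (nth 0 e 0)) ->
  (forall x y, x <= y -> S y -> S x) -> S a -> ~ S b ->
  exists c, forall e, 0 < e -> S (c - e) /\ ~ S (c + e).
Proof.
move=> [f fS]; have [g gs gf] := qe_formula f.
have [s sP] := formula_breaks gs; apply: (@breaks_sup _ s) => u v uv h.
have := sP u v uv h; have := gf [:: u]; have := gf [:: v].
by have := fS [:: u] erefl; have := fS [:: v] erefl; rewrite /=; tauto.
Qed.

End OMinimality.

Section RowsAndSeqs.
Variable R : rcfType.

Definition rowof n (e : seq R) : 'rV[R]_n := \row_i nth 0 e i.

Lemma size_env n (x : 'rV[R]_n) : size (env x) = n.
Proof. by rewrite size_map size_enum_ord. Qed.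

Lemma nth_env n (x : 'rV[R]_n) (i : 'I_n) : nth 0 (env x) i = x 0 i.
Proof. by rewrite (nth_map i) ?size_enum_ord // nth_ord_enum. Qed.

Lemma envK n (x : 'rV[R]_n) : rowof n (env x) = x.
Proof. by apply/rowP => i; rewrite mxE nth_env. Qed.

Lemma rowofK n (e : seq R) : size e = n -> env (rowof n e) = e.
Proof.
move=> se; apply: (@eq_from_nth _ 0); rewrite size_env // => i ilt.
by rewrite (nth_env _ (Ordinal ilt)) mxE.
Qed.

Lemma env_row_mx n m (x : 'rV[R]_n) (y : 'rV[R]_m) :
  env (row_mx x y) = env x ++ env y.
Proof.
apply: (@eq_from_nth _ 0); rewrite ?size_cat !size_env // => i ilt.
rewrite (nth_env _ (Ordinal ilt)) nth_cat size_env mxE.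
case: splitP => k /= ->; first by rewrite ltn_ord nth_env.
by rewrite ltnNge leq_addr /= addKn nth_env.
Qed.

Lemma env_const (c : R) : env (const_mx c : 'rV[R]_1) = [:: c].
Proof.
apply: (@eq_from_nth _ 0); rewrite size_env // => i ilt.
by rewrite (nth_env _ (Ordinal ilt)) mxE; case: i ilt.
Qed.

Lemma semialgebraicP n (A : set 'rV[R]_n) :
  semialgebraic A <-> definable n (fun e => A (rowof n e)).
Proof.
split=> [[f _ ->]|[f fA]].
  by exists f => e se; rewrite /sat /= rowofK.
have [g gs gf] := qe_formula f; exists g => //; apply/seteqP.
split=> x; rewrite /sat /= gf fA ?size_env ?envK //.
Qed.

End RowsAndSeqs.

Section SemialgebraicFunctions.
Variable R : rcfType.

Record sa_set n := SaSet {
  sa_carrier :> set 'rV[R]_n;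
  sa_carrierP : semialgebraic sa_carrier }.

Definition graph n m (M : set 'rV[R]_n) (f : M -> 'rV[R]_m) : set 'rV[R]_(n + m) :=
  range (fun x : M => row_mx (val x) (f x)).

(* Graph of a scalar function, R being identified with R^1. *)
Definition fgraph n (M : set 'rV[R]_n) (f : M -> R) : set 'rV[R]_(n + 1) :=
  graph (fun x => const_mx (f x)).

Lemma graphP n m (M : set 'rV[R]_n) (f : M -> 'rV[R]_m) (e s : seq R) :
  size e = n -> size s = m ->
  (graph f (rowof (n + m) (e ++ s)) <->
   exists x : M, env (val x) = e /\ env (f x) = s).
Proof.
move=> se ss; split=> [[x _ /(congr1 (@env _ _))]|[x [<- <-]]].
  rewrite rowofK ?size_cat ?se ?ss // env_row_mx => /eqP.
  by rewrite eqseq_cat ?size_env ?se // => /andP[/eqP ? /eqP ?]; exists x.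
by exists x => //; rewrite -env_row_mx envK.
Qed.

Lemma fgraphP n (M : set 'rV[R]_n) (f : M -> R) (e : seq R) (z : R) :
  size e = n ->
  (fgraph f (rowof (n + 1) (e ++ [:: z])) <->
   exists x : M, env (val x) = e /\ f x = z).
Proof.
move=> se; rewrite /fgraph graphP //; split=> -[x [ex fx]]; exists x.
  by move: fx; rewrite env_const => -[].
by rewrite env_const fx.
Qed.

Lemma env_inj n (M : set 'rV[R]_n) (x y : M) : env (val x) = env (val y) -> x = y.
Proof.
by move=> /(congr1 (rowof n)); rewrite !envK => /val_inj.
Qed.

Definition vars k l : seq (GRing.term R) := [seq GRing.Var R i | i <- iota k l].

Lemma size_vars k l : size (vars k l) = l.
Proof. by rewrite size_map size_iota. Qed.

Lemma eval_vars (a b c : seq R) k l : size a = k -> size b = l ->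
  map (GRing.eval (a ++ b ++ c)) (vars k l) = b.
Proof.
move=> sa sb; rewrite -map_comp; apply: (@eq_from_nth _ 0).
  by rewrite size_map size_iota.
move=> i; rewrite size_map size_iota => ilt.
rewrite (nth_map 0) ?size_iota //= nth_iota //.
by rewrite nth_cat sa ltnNge leq_addr /= addKn nth_cat sb ilt.
Qed.

Lemma split_size k l (e : seq R) : size e = (k + l)%N ->
  exists a b, [/\ e = a ++ b, size a = k & size b = l].
Proof.
move=> se; exists (take k e), (drop k e); rewrite cat_take_drop size_drop se.
by rewrite addKn size_take se; split => //; case: ltngtP (leq_addr l k) => // ->.
Qed.

Lemma size1P (s : seq R) : size s = 1%N -> exists z, s = [:: z].
Proof. by case: s => [|z []] //; exists z. Qed.

Lemma sa_graph_op2 n (M : set 'rV[R]_n) (h : R -> R -> R) (f g : M -> R) :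
  definable 3 (fun e : seq R => nth 0 e 0 = h (nth 0 e 1) (nth 0 e 2)) ->
  semialgebraic (fgraph f) -> semialgebraic (fgraph g) ->
  semialgebraic (fgraph (fun x => h (f x) (g x))).
Proof.
move=> dh /semialgebraicP df /semialgebraicP dg; apply/semialgebraicP.
have sv i : size (vars 0 n ++ [:: GRing.Var R i]) = (n + 1)%N.
  by rewrite size_cat size_vars.
pose tu := vars 0 n ++ [:: GRing.Var R n.+1].
pose tv := vars 0 n ++ [:: GRing.Var R n.+2].
pose th := [:: GRing.Var R n; GRing.Var R n.+1; GRing.Var R n.+2].
have := def_and (def_inst (n + 1 + 2) (s := th) erefl dh)
  (def_and (def_inst (n + 1 + 2) (sv n.+1) df) (def_inst (n + 1 + 2) (sv n.+2) dg)).
move=> /def_ex; apply: def_ext => e /split_size[a [b [-> sa /size1P[z ->]]]].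
have K u v i : nth 0 (a ++ [:: z; u; v]) (n + i) = nth 0 [:: z; u; v] i.
  by rewrite nth_cat sa ltnNge leq_addr addKn.
have E u v : [/\ nth 0 (a ++ [:: z; u; v]) n = z,
   nth 0 (a ++ [:: z; u; v]) n.+1 = u & nth 0 (a ++ [:: z; u; v]) n.+2 = v].
  by split; [have := K u v 0%N|have := K u v 1%N|have := K u v 2%N];
    rewrite ?addn0 ?addn1 ?addn2.
have V u v : map (GRing.eval (a ++ [:: z; u; v])) (vars 0 n) = a.
  exact: (@eval_vars [::]).
rewrite fgraphP //; split.
  case=> -[|u [|v []]] //= _; rewrite -catA !map_cat /= V; have [-> -> ->] := E u v.
  rewrite !fgraphP // => -[-> [[x [xa fx]] [y [ya gy]]]].
  exists x; split=> //; rewrite fx; congr (h _ _).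
  by rewrite -gy; congr g; apply: env_inj; rewrite xa ya.
case=> x [xa hz]; exists [:: f x; g x] => //; rewrite -catA !map_cat /= V.
have [-> -> ->] := E (f x) (g x); rewrite !fgraphP //.
by split=> //; split; exists x.
Qed.

Lemma sa_graph_const n (M : sa_set n) (c : R) :
  semialgebraic (fgraph (fun _ : M => c)).
Proof.
apply/semialgebraicP; have /semialgebraicP dM := sa_carrierP M.
have := def_and (def_inst (n + 1) (size_vars 0 n) dM)
  (def_eq (n + 1) (GRing.Var R n) (GRing.Const c)).
apply: def_ext => e /split_size[a [b [-> sa /size1P[z ->]]]].
have V : map (GRing.eval (a ++ [:: z])) (vars 0 n) = a.
  exact: (@eval_vars [::]).
rewrite fgraphP // V /= nth_cat sa ltnn subnn /=; split.
  case=> Ma ->; exists (exist _ (rowof n a) (mem_set Ma)); split=> //=.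
  by rewrite rowofK.
by case=> x [<- <-]; rewrite envK; split=> //; apply: set_valP.
Qed.

Lemma sa_graph_coord n (M : sa_set n) (i : 'I_n) :
  semialgebraic (fgraph (fun x : M => val x 0 i)).
Proof.
apply/semialgebraicP; have /semialgebraicP dM := sa_carrierP M.
have := def_and (def_inst (n + 1) (size_vars 0 n) dM)
  (def_eq (n + 1) (GRing.Var R n) (GRing.Var R i)).
apply: def_ext => e /split_size[a [b [-> sa /size1P[z ->]]]].
have V : map (GRing.eval (a ++ [:: z])) (vars 0 n) = a.
  exact: (@eval_vars [::]).
rewrite fgraphP // V /= !nth_cat sa ltnn subnn ltn_ord /=; split.
  case=> Ma ->; exists (exist _ (rowof n a) (mem_set Ma)); split=> //=.
    by rewrite rowofK.
  by rewrite mxE.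
by case=> x [<- <-]; rewrite envK nth_env; split=> //; apply: set_valP.
Qed.

Lemma sa_graph_comp n m (M : set 'rV[R]_n) (X : set 'rV[R]_m) (j : M -> X)
    (f : X -> R) :
  semialgebraic (graph (fun x => val (j x))) -> semialgebraic (fgraph f) ->
  semialgebraic (fgraph (f \o j)).
Proof.
move=> /semialgebraicP dj /semialgebraicP df; apply/semialgebraicP.
pose tj := vars 0 n ++ vars (n + 1) m.
pose tf := vars (n + 1) m ++ vars n 1.
have stj : size tj = (n + m)%N by rewrite size_cat !size_vars.
have stf : size tf = (m + 1)%N by rewrite size_cat !size_vars.
have := def_and (def_inst (n + 1 + m) stj dj) (def_inst (n + 1 + m) stf df).
move=> /def_ex; apply: def_ext => e /split_size[a [b [-> sa sb]]].
have V s : size s = m -> [/\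
    map (GRing.eval ((a ++ b) ++ s)) (vars 0 n) = a,
    map (GRing.eval ((a ++ b) ++ s)) (vars n 1) = b &
    map (GRing.eval ((a ++ b) ++ s)) (vars (n + 1) m) = s].
  move=> ss; split.
  - by rewrite -catA; apply: (@eval_vars [::]).
  - by rewrite -catA; apply: eval_vars.
  - by rewrite -[s in map (GRing.eval (_ ++ s))]cats0;
      apply: eval_vars; rewrite ?size_cat ?sa ?sb.
have [z E] := size1P sb.
rewrite [in X in _ <-> X]E fgraphP //; split.
  case=> s ss; have [v1 v2 v3] := V s ss; rewrite !map_cat v1 v2 v3.
  rewrite graphP // E fgraphP // => -[[x [xa xs]] [y [ys fy]]].
  exists x; split=> //=; rewrite -fy; congr f; apply: env_inj.
  by rewrite xs ys.
case=> x [xa /= fz]; exists (env (val (j x))); first exact: size_env.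
have [v1 v2 v3] := V _ (size_env (val (j x))); rewrite !map_cat v1 v2 v3.
rewrite graphP ?size_env // E fgraphP ?size_env //.
by split; [exists x | exists (j x)].
Qed.

End SemialgebraicFunctions.

(* Continuous semialgebraic functions on closed and bounded semialgebraic sets
   are bounded. R need not be archimedean or complete, so compactness is not
   available; a cluster point is found one coordinate at a time. *)
Section Boundedness.
Variable R : rcfType.

Lemma bounded_funP (T : Type) (f : T -> R) :
  bounded_fun f <-> exists B : R, forall x, `|f x| <= B.
Proof.
split=> [/ex_strict_bound_gt0[B _ fB]|[B fB]].
  by exists B => x; apply/ltW/fB.
exists B; split; first exact: num_real.
by move=> C BC x _; apply: le_trans (fB x) (ltW BC).
Qed.

Lemma ler_mx_coord n (x : 'rV[R]_n) i : `|x 0 i| <= `|x|.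
Proof.
rewrite [leRHS]/Num.norm /= mx_normrE.
by apply/bigmax_geP; right; exists (0, i).
Qed.

Lemma bounded_setP n (M : set 'rV[R]_n) :
  bounded_set M -> exists B, forall x i, M x -> `|x 0 i| <= B.
Proof.
move=> /ex_strict_bound_gt0[B _ MB]; exists B => x i Mx.
by apply: le_trans (ler_mx_coord _ _) (ltW (MB x Mx)).
Qed.

Section Cluster.
Variables (m : nat) (M : set 'rV[R]_m) (f : M -> R).
Hypotheses (sf : semialgebraic (fgraph f)) (bM : bounded_set M).
Hypothesis nf : forall B, exists x, B < `|f x|.

Let near_pt (c : seq R) (t : R) (x : M) := t <= f x * f x /\
  forall i : 'I_m, (i < size c)%N -> `|val x 0 i - nth 0 c i| * t < 1.

Lemma near_pt_mono c t t' x : 0 < t' -> t' <= t -> near_pt c t x -> near_pt c t' x.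
Proof.
move=> t0 tt' [h1 h2]; split; first exact: le_trans h1.
move=> i /h2; apply: le_lt_trans; exact: ler_wpM2l.
Qed.

Let S (c : seq R) (i : 'I_m) (u : R) := forall t, 0 < t ->
  exists2 x, near_pt c t x & u <= val x 0 i.

Lemma S_definable c (i : 'I_m) : (size c <= m)%N ->
  definable 1 (fun e : seq R => S c i (nth 0 e 0)).
Proof.
move=> cm; have /semialgebraicP df := sf.
pose V := GRing.Var R.
pose dist l := GRing.Mul (GRing.Add (V l.+2) (GRing.Opp (GRing.Const (nth 0 c l)))) (V 1%N).
have st : size (vars R 2 (m + 1)) = (m + 1)%N by rewrite size_vars.
have d1 := def_inst (1 + 1 + (m + 1)) st df.
have d2 := def_le (1 + 1 + (m + 1)) (V 1%N) (GRing.Mul (V m.+2) (V m.+2)).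
have d3 := def_forall_seq (n := 1 + 1 + (m + 1)) (iota 0 (size c))
  (fun l => def_and (def_lt (1 + 1 + (m + 1)) (dist l) (GRing.NatConst R 1))
     (def_lt (1 + 1 + (m + 1)) (GRing.Opp (dist l)) (GRing.NatConst R 1))).
have d4 := def_le (1 + 1 + (m + 1)) (V 0%N) (V i.+2).
have := def_ex (def_and (def_and d1 d2) (def_and d3 d4)).
move=> /(def_imp (def_lt (1 + 1) (GRing.NatConst R 0) (V 1%N)))/def_all.
apply: def_ext => -[|u []] //= _.
have key t : 0 < t -> ((exists2 x, near_pt c t x & u <= val x 0 i) <->
  (exists2 s, size s = (m + 1)%N &
    ((fgraph f (rowof (m + 1) [seq GRing.eval [:: u, t & s] i | i <- vars R 2 (m + 1)])
     /\ t <= nth 0 s m * nth 0 s m) /\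
    ((forall l, l \in iota 0 (size c) ->
       (nth 0 s l - nth 0 c l) * t < 1 /\ - ((nth 0 s l - nth 0 c l) * t) < 1)
     /\ u <= nth 0 s i)))).
  move=> t0; have E s : size s = (m + 1)%N ->
      [seq GRing.eval [:: u, t & s] i | i <- vars R 2 (m + 1)] = s.
    move=> ss; rewrite -[in LHS](cats0 s).
    exact: (@eval_vars R [:: u; t] s [::] 2 (m + 1)).
  have D w : `|w| * t < 1 <-> w * t < 1 /\ - (w * t) < 1.
    rewrite -{1}(gtr0_norm t0) -normrM ltr_norml ltrNl andbC.
    by split=> [/andP[]|[-> ->]].
  split.
    case=> x [h1 h2] h3; exists (env (val x) ++ [:: f x]).
      by rewrite size_cat size_env.
    rewrite E ?size_cat ?size_env // fgraphP ?size_env //.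
    rewrite nth_cat size_env ltnn subnn /= nth_cat size_env ltn_ord nth_env.
    split; split=> //; first by exists x.
    move=> l; rewrite mem_iota /= add0n => lc.
    have lm := leq_trans lc cm.
    rewrite nth_cat size_env lm (nth_env _ (Ordinal lm)).
    exact/D/(h2 (Ordinal lm) lc).
  case=> s ss; rewrite E //; have [y [z [-> sy /size1P[v ->]]]] := split_size ss.
  rewrite fgraphP // nth_cat sy ltnn subnn /= nth_cat sy ltn_ord.
  case=> -[[x [xy fx]] h1] [h2 h3]; exists x; last by rewrite -nth_env xy.
  split; first by rewrite fx.
  move=> l lc; apply/D; have := h2 l; rewrite mem_iota /= add0n => /(_ lc).
  by rewrite nth_cat sy ltn_ord -xy nth_env.
split=> h.
  by move=> t t0; apply/(key t t0); apply: (h [:: t]).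
move=> [|t []] //= _ t0; exact/(key t t0)/h.
Qed.

Lemma cluster_seq k : (k <= m)%N ->
  exists2 c : seq R, size c = k & forall t, 0 < t -> exists x, near_pt c t x.
Proof.
elim: k => [_|k IH km].
  exists [::] => // t t0; have [x fx] := nf (1 + t); exists x; split=> //.
  have h : t <= `|f x| by apply: le_trans (ltW fx); rewrite lerDr.
  have h1 : 1 <= `|f x| by apply: le_trans (ltW fx); rewrite lerDl ltW.
  have -> : f x * f x = `|f x| * `|f x|.
    by rewrite -normrM ger0_norm // -expr2 sqr_ge0.
  by apply: le_trans h _; rewrite ler_peMl.
have [c sc cP] := IH (ltnW km); pose i := Ordinal km.
have [B MB] := bounded_setP bM.
have [||||c' c'P] := @definable_sup R (S c i) (- B) (B + 1).
- by by apply: S_definable; rewrite sc ltnW.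
- by move=> u v uv Sv t /Sv[x h1 h2]; exists x => //; apply: le_trans h2.
- move=> t /cP[x h]; exists x => //.
  by have := MB (val x) i (set_valP x); rewrite ler_norml => /andP[].
- move=> /(_ 1 ltr01)[x _ h]; have := MB (val x) i (set_valP x).
  by move=> /(le_trans (ler_norm _))/(le_trans h); rewrite gerDl ler10.
exists (rcons c c'); first by rewrite size_rcons sc.
move=> t t0; pose e := t^-1 / 2.
have e0 : 0 < e by rewrite divr_gt0 ?invr_gt0.
have et : e * t < 1 by rewrite /e mulrAC mulVf ?gt_eqF // mul1r invf_lt1 ?ltr1n.
have [S1 /existsNP[t1 /not_implyP[t10 S2]]] := c'P e e0.
have t20 : 0 < Num.max t t1 by rewrite lt_max t0.
have [x h1 h2] := S1 _ t20; exists x.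
have [m1 m2] : t <= Num.max t t1 /\ t1 <= Num.max t t1 by rewrite !le_max !lexx orbT.
have [n1 n2] := near_pt_mono t0 m1 h1.
have n3 := near_pt_mono t10 m2 h1.
split=> // l; rewrite size_rcons ltnS leq_eqVlt nth_rcons => /predU1P[lk|lk].
  have -> : l = i by apply: val_inj; rewrite /= lk sc.
  rewrite /= sc ltnn eqxx; apply: le_lt_trans et; apply: ler_wpM2r; first exact: ltW.
  rewrite ler_distl h2 /= leNgt; apply/negP => h3; apply: S2.
  by exists x => //; apply: ltW.
by rewrite lk; apply: n2.
Qed.

Lemma cluster_point : exists c : 'rV[R]_m, forall t : R, 0 < t ->
  exists2 x : M, t <= f x * f x & forall i, `|val x 0 i - c 0 i| * t < 1.
Proof.
have [c sc cP] := cluster_seq (leqnn m); exists (rowof m c) => t /cP[x [h1 h2]].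
by exists x => // i; rewrite mxE; apply: h2; rewrite sc.
Qed.

End Cluster.

Lemma sa_bounded m (M : set 'rV[R]_m) (f : M -> R) :
  closed M -> bounded_set M -> continuous f -> semialgebraic (fgraph f) ->
  bounded_fun f.
Proof.
move=> cM bM cf sf; apply/bounded_funP; apply: contrapT => nf.
have [|c cP] := @cluster_point m M f sf bM.
  move=> B; apply: contrapT => h; apply: nf; exists B => x.
  by rewrite leNgt; apply/negP => ?; apply: h; exists x.
have ballP (t : R) (x : M) : 0 < t -> (forall i, `|val x 0 i - c 0 i| * t < 1) ->
    ball c t^-1 (val x : 'rV[R]_m).
  move=> t0 h; split=> [|i j]; first by rewrite invr_gt0.
  rewrite ord1 -ball_normE /ball_ /= distrC -[t^-1]mul1r.
  by rewrite ltr_pdivlMr.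
have Mc : M c.
  apply: cM => U /nbhs_ballP[e /= e0 eU].
  have e10 : 0 < e^-1 by rewrite invr_gt0.
  have [x _ /(ballP _ _ e10)] := cP _ e10; rewrite invrK => /eU Ux.
  by exists (val x); split=> //; apply: set_valP.
pose x0 : M := exist _ c (mem_set Mc).
have : \forall x \near nbhs x0, `|f x0 - f x| < 1.
  have /cvgrPdist_lt := cf x0; apply; exact: ltr01.
case=> _ [/= [W oW <-] /= Wc] sW.
have /nbhs_ballP[e /= e0 eW] : nbhs c W by exact: open_nbhs_nbhs.
pose b := (`|f x0| + 1); pose t := e^-1 + b * b.
have b0 : 0 < b by rewrite ltr_wpDl.
have e10 : 0 < e^-1 by rewrite invr_gt0.
have bb0 : 0 < b * b by rewrite mulr_gt0.
have t0 : 0 < t by rewrite addr_gt0.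
have [x h1 /(ballP _ _ t0) h2] := cP t t0.
have /sW : W (val x).
  apply: eW; apply: le_ball h2; rewrite -[leRHS]invrK lef_pV2 ?posrE //.
  by rewrite /t lerDl ltW.
rewrite /= => h3.
have fb : `|f x| < b.
  rewrite /b -[f x](subrK (f x0)) addrC; apply: le_lt_trans (ler_normD _ _) _.
  by rewrite ltrD2l distrC.
have : f x * f x < b * b.
  have -> : f x * f x = `|f x| * `|f x|.
    by rewrite -normrM ger0_norm // -expr2 sqr_ge0.
  by rewrite ltr_pM.
move=> /(le_lt_trans h1); rewrite /t -[ltRHS]add0r ltrD2r => /lt_trans/(_ e10).
by rewrite ltxx.
Qed.

End Boundedness.

Local Open Scope quotient_scope.

Record prime_ideal (A : comPzRingType) := PrimeIdeal {
  ideal_pred :> {pred A};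
  ideal_zmod : zmod_closed ideal_pred;
  ideal_absorb : forall a x, x \in ideal_pred -> a * x \in ideal_pred;
  ideal_proper : 1 \notin ideal_pred;
  ideal_prime : forall x y,
    x * y \in ideal_pred -> (x \in ideal_pred) || (y \in ideal_pred) }.

HB.instance Definition _ (A : comPzRingType) (p : prime_ideal A) :=
  GRing.isZmodClosed.Build A (ideal_pred p) (ideal_zmod p).

(* Mathcomp's {ideal_quot I} requires 1 != 0 in the base ring, which fails for
   the ring of functions on the empty set. *)
Definition prime_quot (A : comPzRingType) (p : prime_ideal A) : Type :=
  Quotient.quot (ideal_pred p : zmodClosed A).

Section PrimeQuotient.
Variables (A : comPzRingType) (p : prime_ideal A).
Local Notation Q := (prime_quot p).

HB.instance Definition _ := GRing.Zmodule.on Q.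

Definition pq_proj (x : A) : Q :=
  \pi_(Quotient.quot (ideal_pred p : zmodClosed A)) x.

Lemma pq_proj_eq x y : (pq_proj x == pq_proj y) = (x - y \in p).
Proof. by rewrite Quotient.idealrBE. Qed.

Lemma pq_projB : zmod_morphism pq_proj.
Proof. by move=> x y; rewrite /pq_proj raddfB. Qed.

HB.instance Definition _ := GRing.isZmodMorphism.Build A Q pq_proj pq_projB.

Definition pq_repr (u : Q) : A :=
  repr (u : Quotient.quot (ideal_pred p : zmodClosed A)).

Lemma pq_reprK : cancel pq_repr pq_proj.
Proof. by move=> u; apply: reprK. Qed.

Lemma pq_repr_proj x : x - pq_repr (pq_proj x) \in p.
Proof. by rewrite -pq_proj_eq pq_reprK. Qed.

Definition pq_one : Q := pq_proj 1.
Definition pq_mul (u v : Q) : Q := pq_proj (pq_repr u * pq_repr v).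

Lemma pq_projM x y : pq_proj (x * y) = pq_mul (pq_proj x) (pq_proj y).
Proof.
apply/eqP; rewrite pq_proj_eq.
set x' := pq_repr _; set y' := pq_repr _.
have -> : x * y - x' * y' = y * (x - x') + x' * (y - y').
  by rewrite !mulrBr [y * x]mulrC [y * x']mulrC addrA subrK.
by rewrite rpredD // ideal_absorb // pq_repr_proj.
Qed.

Lemma pq_mulA : associative pq_mul.
Proof.
move=> u v w; rewrite -[u]pq_reprK -[v]pq_reprK -[w]pq_reprK.
by rewrite -!pq_projM mulrA.
Qed.

Lemma pq_mulC : commutative pq_mul.
Proof. by move=> u v; rewrite /pq_mul mulrC. Qed.

Lemma pq_mul1 : left_id pq_one pq_mul.
Proof. by move=> u; rewrite -[u]pq_reprK -pq_projM mul1r. Qed.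

Lemma pq_mulDl : left_distributive pq_mul +%R.
Proof.
move=> u v w; rewrite -[u]pq_reprK -[v]pq_reprK -[w]pq_reprK.
by rewrite -raddfD -!pq_projM mulrDl raddfD.
Qed.

Lemma pq_proj_eq0 x : (pq_proj x == 0) = (x \in p).
Proof. by rewrite -(raddf0 pq_proj) pq_proj_eq subr0. Qed.

Lemma pq_one_neq0 : pq_one != 0.
Proof. by rewrite pq_proj_eq0 ideal_proper. Qed.

HB.instance Definition _ := GRing.Zmodule_isComNzRing.Build Q
  pq_mulA pq_mulC pq_mul1 pq_mulDl pq_one_neq0.

Lemma pq_proj_monoid : monoid_morphism pq_proj.
Proof. by split=> // x y; rewrite pq_projM. Qed.

HB.instance Definition _ :=
  GRing.isMonoidMorphism.Build A Q pq_proj pq_proj_monoid.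

Definition pq_unit : {pred Q} := [pred u | `[< exists v, v * u = 1 >]].
Definition pq_inv (u : Q) : Q := xget u [set v | v * u = 1].

Lemma pq_mulVr : {in pq_unit, left_inverse 1 pq_inv *%R}.
Proof.
move=> u /asboolP[w uw]; rewrite /pq_inv; case: xgetP => [v _ //|no].
by case: (no w).
Qed.

Lemma pq_unitP u v : v * u = 1 -> pq_unit u.
Proof. by move=> uv; apply/asboolP; exists v. Qed.

Lemma pq_inv_out : {in [predC pq_unit], pq_inv =1 id}.
Proof.
move=> u; rewrite inE /= => nu; rewrite /pq_inv; case: xgetP => // v _ uv.
by case/negP: nu; apply: pq_unitP uv.
Qed.

HB.instance Definition _ := GRing.ComNzRing_hasMulInverse.Build Q
  pq_mulVr pq_unitP pq_inv_out.

Lemma pq_integral (u v : Q) : u * v = 0 -> (u == 0) || (v == 0).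
Proof.
rewrite -[u]pq_reprK -[v]pq_reprK -rmorphM => /eqP.
by rewrite !pq_proj_eq0 => /ideal_prime.
Qed.

HB.instance Definition _ := GRing.ComUnitRing_isIntegral.Build Q pq_integral.

End PrimeQuotient.

Section Kernel.
Variables (A : comPzRingType) (K : fieldType) (phi : {rmorphism A -> K}).

Definition ker_pred : {pred A} := [pred x | phi x == 0].

Lemma ker_zmod : zmod_closed ker_pred.
Proof.
split=> [|x y]; rewrite !inE ?rmorph0 //.
by move=> /eqP x0 /eqP y0; rewrite rmorphB x0 y0 subr0.
Qed.

Lemma ker_absorb a x : x \in ker_pred -> a * x \in ker_pred.
Proof. by rewrite !inE => /eqP x0; rewrite rmorphM x0 mulr0. Qed.

Lemma ker_proper : 1 \notin ker_pred.
Proof. by rewrite inE rmorph1 oner_eq0. Qed.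

Lemma ker_prime x y : x * y \in ker_pred -> (x \in ker_pred) || (y \in ker_pred).
Proof. by rewrite !inE rmorphM mulf_eq0. Qed.

Definition ker_ideal : prime_ideal A :=
  PrimeIdeal ker_zmod ker_absorb ker_proper ker_prime.

Definition ker_ind (u : prime_quot ker_ideal) : K := phi (pq_repr u).

Lemma ker_ind_proj x : ker_ind (pq_proj ker_ideal x) = phi x.
Proof.
apply/esym/eqP; rewrite -subr_eq0 -rmorphB.
exact: (pq_repr_proj ker_ideal x).
Qed.

Lemma ker_ind_zmod : zmod_morphism ker_ind.
Proof.
move=> u v; rewrite -[u]pq_reprK -[v]pq_reprK -rmorphB !ker_ind_proj.
by rewrite rmorphB.
Qed.

Lemma ker_ind_monoid : monoid_morphism ker_ind.
Proof.
split=> [|u v]; first by rewrite -(rmorph1 (pq_proj ker_ideal)) ker_ind_proj rmorph1.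
rewrite -[u]pq_reprK -[v]pq_reprK -rmorphM !ker_ind_proj.
by rewrite rmorphM.
Qed.

HB.instance Definition _ :=
  GRing.isZmodMorphism.Build (prime_quot ker_ideal) K ker_ind ker_ind_zmod.
HB.instance Definition _ :=
  GRing.isMonoidMorphism.Build (prime_quot ker_ideal) K ker_ind ker_ind_monoid.

Lemma ker_ind_inj : injective ker_ind.
Proof.
move=> u v; rewrite -[u]pq_reprK -[v]pq_reprK !ker_ind_proj => uv.
by apply/eqP; rewrite pq_proj_eq inE rmorphB uv subrr.
Qed.

End Kernel.

Arguments ker_ind {A K} phi u.

Section Contraction.
Variables (A B : comPzRingType) (f : {rmorphism A -> B}) (p : prime_ideal B).

Definition contraction_pred : {pred A} := [pred x | f x \in p].

Lemma contraction_zmod : zmod_closed contraction_pred.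
Proof.
split=> [|x y]; rewrite !inE ?rmorph0 ?rpred0 //.
by move=> xp yp; rewrite rmorphB rpredB.
Qed.

Lemma contraction_absorb a x :
  x \in contraction_pred -> a * x \in contraction_pred.
Proof. by rewrite !inE rmorphM; apply: ideal_absorb. Qed.

Lemma contraction_proper : 1 \notin contraction_pred.
Proof. by rewrite inE rmorph1 ideal_proper. Qed.

Lemma contraction_prime x y : x * y \in contraction_pred ->
  (x \in contraction_pred) || (y \in contraction_pred).
Proof. by rewrite !inE rmorphM; apply: ideal_prime. Qed.

Definition contracted_ideal : prime_ideal A := PrimeIdeal contraction_zmod
  contraction_absorb contraction_proper contraction_prime.

Definition quot_ind (u : prime_quot contracted_ideal) : prime_quot p :=
  pq_proj p (f (pq_repr u)).

Lemma quot_ind_proj x : quot_ind (pq_proj contracted_ideal x) = pq_proj p (f x).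
Proof.
apply/esym/eqP; rewrite pq_proj_eq -rmorphB.
exact: (pq_repr_proj contracted_ideal x).
Qed.

Lemma quot_ind_zmod : zmod_morphism quot_ind.
Proof.
move=> u v; rewrite -[u]pq_reprK -[v]pq_reprK -(rmorphB (pq_proj contracted_ideal)) !quot_ind_proj.
by rewrite !rmorphB.
Qed.

Lemma quot_ind_monoid : monoid_morphism quot_ind.
Proof.
split=> [|u v].
  by rewrite -(rmorph1 (pq_proj contracted_ideal)) quot_ind_proj !rmorph1.
rewrite -[u]pq_reprK -[v]pq_reprK -(rmorphM (pq_proj contracted_ideal)) !quot_ind_proj.
by rewrite !rmorphM.
Qed.

HB.instance Definition _ := GRing.isZmodMorphism.Build
  (prime_quot contracted_ideal) (prime_quot p) quot_ind quot_ind_zmod.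
HB.instance Definition _ := GRing.isMonoidMorphism.Build
  (prime_quot contracted_ideal) (prime_quot p) quot_ind quot_ind_monoid.

Lemma quot_ind_inj : injective quot_ind.
Proof.
move=> u v; rewrite -[u]pq_reprK -[v]pq_reprK !quot_ind_proj => /eqP.
by rewrite pq_proj_eq -rmorphB => fp; apply/eqP; rewrite pq_proj_eq.
Qed.

End Contraction.

Arguments quot_ind {A B} f p u.

Notation "x %:F" := (@FracField.tofrac _ x) : ring_scope.

Section FractionMap.
Variables (D E : idomainType) (h : {rmorphism D -> E}).

(* For injective h this is the induced inclusion of fraction fields, see
   frac_mapE below. *)
Definition frac_map (u : {fraction D}) : {fraction E} :=
  (h \n_(repr u))%:F / (h \d_(repr u))%:F.

Hypothesis h_inj : injective h.

Lemma frac_repr (u : {fraction D}) : u = (\n_(repr u))%:F / (\d_(repr u))%:F.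
Proof.
rewrite -[LHS]reprK; set r := repr u; unlock FracField.tofrac.
rewrite -[_^-1]FracField.pi_inv -[RHS]FracField.pi_mul.
rewrite /FracField.mulf /FracField.invf.
rewrite !numden_Ratio ?oner_neq0 ?denom_ratioP // mulr1 mul1r.
by rewrite Ratio_numden.
Qed.

Lemma frac_mapE a b : b != 0 ->
  frac_map (a%:F / b%:F) = (h a)%:F / (h b)%:F.
Proof.
move=> b0; set u := a%:F / b%:F; have := frac_repr u.
have := denom_ratioP (repr u); rewrite /frac_map; set c := \n__; set d := \d__.
move=> d0; have nz (x : D) : x != 0 -> (h x)%:F != 0.
  by move=> x0; rewrite tofrac_eq0 -(rmorph0 h) (inj_eq h_inj).
move=> /eqP; rewrite eqr_div ?tofrac_eq0 // -!tofracM tofrac_eq => /eqP abcd.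
by apply/eqP; rewrite eqr_div ?nz // -!tofracM -!rmorphM abcd.
Qed.

End FractionMap.

Section SemialgebraicRing.
Variable R : rcfType.

Definition semialg_fun (bd : bool) n (M : sa_set R n) : {pred M -> R} :=
  [pred f : M -> R | `[< [/\ continuous f, semialgebraic (fgraph f) &
                         (bd -> bounded_fun f)] >]].

Arguments semialg_fun bd {n} M.

Lemma semialg_funP (bd : bool) n (M : sa_set R n) (f : M -> R) :
  reflect [/\ continuous f, semialgebraic (fgraph f) & (bd -> bounded_fun f)]
          (f \in semialg_fun bd M).
Proof. exact: asboolP. Qed.

Lemma semialg_fun_cst bd n (M : sa_set R n) (c : R) :
  (fun _ => c) \in semialg_fun bd M.
Proof.
apply/semialg_funP; split=> [||_]; first exact: cst_continuous.
- exact: sa_graph_const.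
- by apply/bounded_funP; exists `|c|.
Qed.

Lemma semialg_fun_subring bd n (M : sa_set R n) :
  subring_closed (semialg_fun bd M).
Proof.
split=> [|f g /semialg_funP[cf sf bf] /semialg_funP[cg sg bg]
         |f g /semialg_funP[cf sf bf] /semialg_funP[cg sg bg]].
- exact: semialg_fun_cst.
- apply/semialg_funP; split=> [x||b].
  + exact: continuousB (cf x) (cg x).
  + apply: (sa_graph_op2 (h := fun u v => u - v)) => //.
    exact: (def_eq 3 (GRing.Var R 0)
      (GRing.Add (GRing.Var R 1) (GRing.Opp (GRing.Var R 2)))).
  + apply/bounded_funP; have /bounded_funP[B fB] := bf b.
    have /bounded_funP[C gC] := bg b; exists (B + C) => x.
    by apply: le_trans (ler_normB _ _) _; apply: lerD.
- apply/semialg_funP; split=> [x||b].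
  + exact: continuousM (cf x) (cg x).
  + apply: (sa_graph_op2 (h := fun u v => u * v)) => //.
    exact: (def_eq 3 (GRing.Var R 0)
      (GRing.Mul (GRing.Var R 1) (GRing.Var R 2))).
  + apply/bounded_funP; have /bounded_funP[B fB] := bf b.
    have /bounded_funP[C gC] := bg b; exists (B * C) => x.
    by rewrite normrM ler_pM.
Qed.

HB.instance Definition _ bd n (M : sa_set R n) :=
  GRing.isSubringClosed.Build (M -> R) (semialg_fun bd M)
    (semialg_fun_subring bd M).

(* The ring of semialgebraic functions on M (bd = false), or of bounded
   semialgebraic functions on M (bd = true). *)
Record sa_ring (bd : bool) n (M : sa_set R n) := SaRing {
  sa_val :> M -> R;
  sa_valP : sa_val \in semialg_fun bd M }.

Section Instances.
Variables (bd : bool) (n : nat) (M : sa_set R n).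
HB.instance Definition _ := [isSub for (@sa_val bd n M)].
HB.instance Definition _ := [Choice of sa_ring bd M by <:].
HB.instance Definition _ := GRing.SubChoice_isSubComPzRing.Build
  (M -> R) (semialg_fun bd M) (sa_ring bd M) (semialg_fun_subring bd M).
End Instances.

Definition sa_cst bd n (M : sa_set R n) (c : R) : sa_ring bd M :=
  SaRing (semialg_fun_cst bd M c).

Lemma semialg_fun_coord n (M : sa_set R n) (i : 'I_n) :
  (fun x : M => val x 0 i) \in semialg_fun false M.
Proof.
apply/semialg_funP; split=> //; last exact: sa_graph_coord.
move=> x; apply: (@continuous_comp M _ _ val (fun y : 'rV[R]_n => y 0 i)).
  exact: initial_continuous.
exact: coord_continuous.
Qed.

Definition sa_coord n (M : sa_set R n) (i : 'I_n) : sa_ring false M :=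
  SaRing (semialg_fun_coord M i).

End SemialgebraicRing.

Arguments semialg_fun {R} bd {n} M.

Section PseudoCompactification.
Variables (R : rcfType) (n : nat) (M : sa_set R n).

Definition homeo_onto_image (T U : topologicalType) (j : T -> U) : Prop :=
  continuous j /\ exists g : range j -> T,
    [/\ continuous g, forall y, j (g y) = val y &
        forall x y, val y = j x -> g y = x].

Record pseudo_compactification (m : nat) := PseudoCompactification {
  pc_set :> sa_set R m;
  pc_emb : M -> pc_set;
  pc_closed : closed pc_set;
  pc_bounded : bounded_set pc_set;
  pc_semialg : semialgebraic (graph (fun x => val (pc_emb x)));
  pc_homeo : homeo_onto_image pc_emb;
  pc_dense : dense (range pc_emb) }.

Variables (m : nat) (X : pseudo_compactification m) (bd : bool).

Lemma pullback_subproof (a : sa_ring false X) :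
  a \o pc_emb X \in semialg_fun bd M.
Proof.
have /semialg_funP[ca sa _] := sa_valP a; have [cj _] := pc_homeo X.
apply/semialg_funP; split=> [x||_].
- by apply: continuous_comp; [exact: cj | exact: ca].
- exact: sa_graph_comp (pc_semialg X) sa.
- have /bounded_funP[B aB] := sa_bounded (@pc_closed _ X) (@pc_bounded _ X) ca sa.
  by apply/bounded_funP; exists B => x; apply: aB.
Qed.

Definition pullback (a : sa_ring false X) : sa_ring bd M :=
  SaRing (pullback_subproof a).

Lemma pullback_zmod : zmod_morphism pullback.
Proof. by move=> a b; apply: val_inj. Qed.

Lemma pullback_monoid : monoid_morphism pullback.
Proof. by split=> [|a b]; apply: val_inj. Qed.

HB.instance Definition _ := GRing.isZmodMorphism.Build
  (sa_ring false X) (sa_ring bd M) pullback pullback_zmod.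
HB.instance Definition _ := GRing.isMonoidMorphism.Build
  (sa_ring false X) (sa_ring bd M) pullback pullback_monoid.

End PseudoCompactification.

Arguments pullback {R n M m} X bd a.

(* qf(S(X) / (p `&` S(X))) = qf(S(M) / p), the identification being the field
   inclusion induced by the pullback. *)
Definition brimming (R : rcfType) n (M : sa_set R n) m
    (X : pseudo_compactification M m) bd (p : prime_ideal (sa_ring bd M)) : Prop :=
  bijective (frac_map (quot_ind (pullback X bd) p)).

Section Extension.
Variables (R F : rcfType) (iota : {rmorphism R -> F}).

Fixpoint map_term (t : GRing.term R) : GRing.term F :=
  match t with
  | GRing.Var i => GRing.Var F i
  | GRing.Const c => GRing.Const (iota c)
  | GRing.NatConst n => GRing.NatConst F n
  | GRing.Add t1 t2 => GRing.Add (map_term t1) (map_term t2)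
  | GRing.Opp t1 => GRing.Opp (map_term t1)
  | GRing.NatMul t1 n => GRing.NatMul (map_term t1) n
  | GRing.Mul t1 t2 => GRing.Mul (map_term t1) (map_term t2)
  | GRing.Inv t1 => GRing.Inv (map_term t1)
  | GRing.Exp t1 n => GRing.Exp (map_term t1) n
  end.

Fixpoint map_formula (f : ord.formula R) : ord.formula F :=
  match f with
  | ord.Bool b => ord.Bool b
  | ord.Equal t1 t2 => ord.Equal (map_term t1) (map_term t2)
  | ord.Lt t1 t2 => ord.Lt (map_term t1) (map_term t2)
  | ord.Le t1 t2 => ord.Le (map_term t1) (map_term t2)
  | ord.Unit t1 => ord.Unit (map_term t1)
  | ord.And f1 f2 => ord.And (map_formula f1) (map_formula f2)
  | ord.Or f1 f2 => ord.Or (map_formula f1) (map_formula f2)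
  | ord.Implies f1 f2 => ord.Implies (map_formula f1) (map_formula f2)
  | ord.Not f1 => ord.Not (map_formula f1)
  | ord.Exists i f1 => ord.Exists i (map_formula f1)
  | ord.Forall i f1 => ord.Forall i (map_formula f1)
  end.

(* By Tarski-Seidenberg this does not depend on the formula f defining A. *)
Definition sa_ext n (A : set 'rV[R]_n) : set 'rV[F]_n :=
  [set y | exists f, [/\ sign_formula f, A = sat f & sat (map_formula f) y]].

(* The function on sa_ext M whose graph is the extension of the graph of a,
   set to 0 outside sa_ext M. *)
Definition fun_ext n (M : set 'rV[R]_n) (a : M -> R) (y : 'rV[F]_n) : F :=
  xget 0 [set z | sa_ext (fgraph a) (row_mx y (const_mx z))].

(* Compatibility with the structures of R-algebra, given on F by iota. *)
Definition R_hom bd n (M : sa_set R n) (phi : sa_ring bd M -> F) : Prop :=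
  forall c, phi (sa_cst bd M c) = iota c.

Definition hom_core m (X : sa_set R m) (psi : sa_ring false X -> F) : 'rV[F]_m :=
  \row_i psi (sa_coord X i).

End Extension.

(* Main.v *)
Require Import Defs.
From HB Require Import structures.
From mathcomp Require Import all_boot all_order all_algebra.
From mathcomp Require Import generic_quotient fraction ring_quotient.
From mathcomp.real_closed Require Import polyrcf qe_rcf_th ordered_qelim qe_rcf.
From mathcomp Require Import boolp classical_sets functions.
From mathcomp Require Import topology normedtype.

Import Order.TTheory GRing.Theory Num.Theory.
Import numFieldNormedType.Exports.

Local Open Scope classical_set_scope.
Local Open Scope ring_scope.

(* The point is that psi a = a_F(p) for an R-homomorphism psi : S(X) -> F with
   X closed and bounded, p being its core. Nonnegative elements of S(X) are
   squares, so psi preserves signs weakly. If h, g >= 0 in S(X) and g vanishes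
   wherever h does, Lojasiewicz's inequality g^k <= C h shows that psi h = 0
   forces psi g = 0. Hence the signs of psi a_1, ..., psi a_l are always realised
   by a_1(x), ..., a_l(x) at some point x of X, and a sign condition valid for
   the a_i on all of X passes to the psi a_i. Applied to formulas defining X and
   the graph of a, this puts p in X_F and (p, psi a) in the extended graph; that
   the extended graph is functional is an instance of the transfer principle.
   Since X is brimming, phi is then recovered from psi by taking quotients. *)

Set Implicit Arguments.
Unset Strict Implicit.
Unset Printing Implicit Defensive.

(** * The transfer principle *)

Section Transfer.
Variables (R F : rcfType) (iota : {rmorphism R -> F}).

(** Quantifier elimination computes in the syntax of [qe_rcf], whose terms have no inverse and whose
    formulas have no quantifier, so [iota] has to act on that syntax too. [map_formula_of_qf]
    reconciles this action with [map_formula]. *)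
Fixpoint qmap_term (t : qe_rcf.term R) : qe_rcf.term F :=
  match t with
  | qe_rcf.Var i => qe_rcf.Var F i
  | qe_rcf.Const c => qe_rcf.Const (iota c)
  | qe_rcf.NatConst n => qe_rcf.NatConst F n
  | qe_rcf.Add t1 t2 => qe_rcf.Add (qmap_term t1) (qmap_term t2)
  | qe_rcf.Opp t1 => qe_rcf.Opp (qmap_term t1)
  | qe_rcf.NatMul t1 n => qe_rcf.NatMul (qmap_term t1) n
  | qe_rcf.Mul t1 t2 => qe_rcf.Mul (qmap_term t1) (qmap_term t2)
  | qe_rcf.Exp t1 n => qe_rcf.Exp (qmap_term t1) n
  end.

Fixpoint qmap_formula (f : qe_rcf.formula R) : qe_rcf.formula F :=
  match f with
  | qe_rcf.Bool b => qe_rcf.Bool b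
  | qe_rcf.Equal t1 t2 => qe_rcf.Equal (qmap_term t1) (qmap_term t2)
  | qe_rcf.Lt t1 t2 => qe_rcf.Lt (qmap_term t1) (qmap_term t2)
  | qe_rcf.Le t1 t2 => qe_rcf.Le (qmap_term t1) (qmap_term t2)
  | qe_rcf.And f1 f2 => qe_rcf.And (qmap_formula f1) (qmap_formula f2)
  | qe_rcf.Or f1 f2 => qe_rcf.Or (qmap_formula f1) (qmap_formula f2)
  | qe_rcf.Implies f1 f2 => qe_rcf.Implies (qmap_formula f1) (qmap_formula f2)
  | qe_rcf.Not f1 => qe_rcf.Not (qmap_formula f1)
  end.

Local Notation mt := qmap_term.
Local Notation mf := qmap_formula.
Local Notation mp := (map qmap_term).

Lemma map_term_of_rterm (t : qe_rcf.term R) : map_term iota t = mt t.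
Proof. by elim: t => //= *; congruence. Qed.

Lemma map_formula_of_qf (f : qe_rcf.formula R) : map_formula iota f = mf f.
Proof. by elim: f => //= *; rewrite ?map_term_of_rterm //; congruence. Qed.

Lemma to_rterm_map_term (t : GRing.term R) :
  to_rterm (map_term iota t) = mt (to_rterm t).
Proof. by elim: t => //= *; congruence. Qed.

(* Quantifier elimination is written in continuation-passing style, so each
   step commutes with iota as soon as its continuation does. *)
Lemma qmap_Size p k k' : (forall n, k' n = mf (k n)) ->
  Size (mp p) k' = mf (Size p k).
Proof.
elim: p k k' => [|c p IH] k k' kk' /=; first exact: kk'.
by apply: IH => -[|n] /=; rewrite !kk'.
Qed.

Lemma qmap_Isnull p k k' : (forall b, k' b = mf (k b)) ->
  Isnull (mp p) k' = mf (Isnull p k).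
Proof. by move=> kk'; apply: qmap_Size => n; apply: kk'. Qed.

Lemma qmap_LtSize p q k k' : (forall b, k' b = mf (k b)) ->
  LtSize (mp p) (mp q) k' = mf (LtSize p q k).
Proof. by move=> kk'; apply: qmap_Size => n; apply: qmap_Size => l; apply: kk'. Qed.

Lemma qmap_LeadCoef p k k' : (forall c, k' (mt c) = mf (k c)) ->
  LeadCoef (mp p) k' = mf (LeadCoef p k).
Proof.
elim: p k k' => [|c p IH] k k' kk' /=; first by rewrite -kk' /= rmorph0.
by apply: IH => l /=; rewrite !kk'.
Qed.

Lemma qmap_AmulXn a n : AmulXn (mt a) n = mp (AmulXn a n).
Proof. by elim: n => //= n ->; rewrite rmorph0. Qed.

Lemma qmap_AddPoly p q : AddPoly (mp p) (mp q) = mp (AddPoly p q).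
Proof. by elim: p q => [|a p IH] [|b q] //=; rewrite IH. Qed.

Lemma qmap_ScalPoly c p : ScalPoly (mt c) (mp p) = mp (ScalPoly c p).
Proof. by rewrite /ScalPoly -!map_comp. Qed.

Lemma qmap_MulPoly p q : MulPoly (mp p) (mp q) = mp (MulPoly p q).
Proof.
elim: p => //= a p IH.
by rewrite IH qmap_ScalPoly -qmap_AddPoly.
Qed.

Lemma qmap_ExpPoly p n : ExpPoly (mp p) n = mp (ExpPoly p n).
Proof.
case: n => [|n] //; rewrite /ExpPoly !iteropS.
by elim: n => //= n ->; rewrite qmap_MulPoly.
Qed.

Lemma qmap_OppPoly p : OppPoly (mp p) = mp (OppPoly p).
Proof. by rewrite /OppPoly -qmap_ScalPoly /= rmorphN rmorph1. Qed.

Lemma qmap_NatMulPoly n p : NatMulPoly n (mp p) = mp (NatMulPoly n p).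
Proof. by rewrite /NatMulPoly -qmap_ScalPoly. Qed.

Lemma qmap_Deriv p : Deriv (mp p) = mp (Deriv p).
Proof. by elim: p => //= a p IH; rewrite IH -qmap_AddPoly. Qed.

Lemma qmap_Rediv_rec_loop q sq cq c qq r n k k' :
  (forall c qq r, k' (c, mp qq, mp r) = mf (k (c, qq, r))) ->
  Rediv_rec_loop (mp q) sq (mt cq) c (mp qq) (mp r) n k' =
  mf (Rediv_rec_loop q sq cq c qq r n k).
Proof.
elim: n c qq r k k' => [|n IH] c qq r k k' kk' /=.
  apply: qmap_Size => sr; case: ifP => _; first exact: kk'.
  apply: qmap_LeadCoef => lr; rewrite -kk' qmap_AmulXn -[[:: mt cq]]/(mp [:: cq]).
  by rewrite !qmap_MulPoly qmap_OppPoly !qmap_AddPoly.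
apply: qmap_Size => sr; case: ifP => _; first exact: kk'.
apply: qmap_LeadCoef => lr; rewrite -(IH _ _ _ _ _ kk') qmap_AmulXn.
by rewrite -[[:: mt cq]]/(mp [:: cq]) !qmap_MulPoly qmap_OppPoly !qmap_AddPoly.
Qed.

Lemma qmap_Rediv p q k k' :
  (forall c qq r, k' (c, mp qq, mp r) = mf (k (c, qq, r))) ->
  Rediv (mp p) (mp q) k' = mf (Rediv p q k).
Proof.
(* Constants created by the elimination match their images only after rewriting [iota 0] to 0. *)
have E : [:: qe_rcf.Const (0 : F)] = mp [:: qe_rcf.Const 0].
  by rewrite /= rmorph0.
move=> kk'; apply: qmap_Isnull => -[]; first by rewrite E.
apply: qmap_Size => sq; apply: qmap_Size => sp; apply: qmap_LeadCoef => lq.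
by rewrite E; apply: qmap_Rediv_rec_loop.
Qed.

Lemma qmap_Rgcd_loop n p q k k' : (forall p, k' (mp p) = mf (k p)) ->
  Rgcd_loop n (mp p) (mp q) k' = mf (Rgcd_loop n p q k).
Proof.
elim: n p q k k' => [|n IH] p q k k' kk' /=;
  apply: qmap_Rediv => c qq r /=; apply: qmap_Isnull => -[] //; exact: IH.
Qed.

Lemma qmap_Rgcd p q k k' : (forall p, k' (mp p) = mf (k p)) ->
  Rgcd (mp p) (mp q) k' = mf (Rgcd p q k).
Proof.
move=> kk'; apply: qmap_LtSize => -[]; apply: qmap_Isnull => -[] //;
  by apply: qmap_Size => n; apply: qmap_Rgcd_loop.
Qed.

Lemma qmap_BigRgcd ps k k' : (forall p, k' (mp p) = mf (k p)) ->
  BigRgcd (map mp ps) k' = mf (BigRgcd ps k).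
Proof.
elim: ps k k' => [|p ps IH] k k' kk' /=; first by rewrite -kk' /= rmorph0.
by apply: IH => r; apply: qmap_Rgcd.
Qed.

(** * Sign changes, signed remainder sequences and Tarski queries *)

Lemma qmap_Changes s k k' : (forall n, k' n = mf (k n)) ->
  Changes (mp s) k' = mf (Changes s k).
Proof.
elim: s k k' => [|a s IH] k k' kk' /=; first exact: kk'.
by apply: IH => v /=; rewrite !kk'; case: (s).
Qed.

Lemma qmap_SeqPInfty ps k k' : (forall s, k' (mp s) = mf (k s)) ->
  SeqPInfty (map mp ps) k' = mf (SeqPInfty ps k).
Proof.
elim: ps k k' => [|p ps IH] k k' kk' /=; first by rewrite -kk'.
by apply: qmap_LeadCoef => lp; apply: IH => lps; rewrite -kk'.
Qed.

Lemma qmap_SeqMInfty ps k k' : (forall s, k' (mp s) = mf (k s)) ->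
  SeqMInfty (map mp ps) k' = mf (SeqMInfty ps k).
Proof.
elim: ps k k' => [|p ps IH] k k' kk' /=; first by rewrite -kk'.
apply: qmap_LeadCoef => lp; apply: qmap_Size => sp; apply: IH => lps.
by rewrite -kk' /= rmorphN rmorph1.
Qed.

Lemma qmap_ChangesPoly ps k k' : (forall n, k' n = mf (k n)) ->
  ChangesPoly (map mp ps) k' = mf (ChangesPoly ps k).
Proof.
move=> kk'; apply: qmap_SeqMInfty => s; apply: qmap_SeqPInfty => s'.
by apply: qmap_Changes => n; apply: qmap_Changes => n'.
Qed.

Lemma qmap_NextMod p q k k' : (forall p, k' (mp p) = mf (k p)) ->
  NextMod (mp p) (mp q) k' = mf (NextMod p q k).
Proof.
move=> kk'; apply: qmap_LeadCoef => lq; apply: qmap_Rediv => spq ? ? /=.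
by apply: qmap_Rediv => ? ? rpq /=; rewrite -kk' -qmap_ScalPoly.
Qed.

Lemma qmap_ModsAux p q n k k' : (forall s, k' (map mp s) = mf (k s)) ->
  ModsAux (mp p) (mp q) n k' = mf (ModsAux p q n k).
Proof.
elim: n p q k k' => [|n IH] p q k k' kk' /=; first by rewrite -kk'.
apply: qmap_Isnull => -[]; first by rewrite -kk'.
by apply: qmap_NextMod => npq; apply: IH => ps; rewrite -kk'.
Qed.

Lemma qmap_Mods p q k k' : (forall s, k' (map mp s) = mf (k s)) ->
  Mods (mp p) (mp q) k' = mf (Mods p q k).
Proof.
by move=> kk'; apply: qmap_Size => n; apply: qmap_Size => l; apply: qmap_ModsAux.
Qed.

Lemma qmap_PolyComb sq sc : PolyComb (map mp sq) sc = mp (PolyComb sq sc).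
Proof.
rewrite /PolyComb size_map /reducebig; elim: (seq.iota _ _) => //= i r ->.
rewrite -qmap_MulPoly -qmap_ExpPoly.
congr (MulPoly (ExpPoly _ _) _); case: (ltnP i (size sq)) => h; first by rewrite (nth_map [::]).
by rewrite !nth_default ?size_map.
Qed.

Lemma qmap_Pcq sq i : Pcq (map mp sq) i = mp (Pcq sq i).
Proof.
rewrite /Pcq size_map; set s := sg_tab _.
case: (ltnP i (size s)) => h; last by rewrite !nth_default ?size_map.
by rewrite !(nth_map [::]) // qmap_PolyComb.
Qed.

Lemma qmap_TaqsR p sq i k k' : (forall x, k' (mt x) = mf (k x)) ->
  TaqsR (mp p) (map mp sq) i k' = mf (TaqsR p sq i k).
Proof.
move=> kk'; rewrite /TaqsR /TaqR /bind_def qmap_Deriv qmap_Pcq qmap_MulPoly.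
apply: qmap_Mods => r; apply: qmap_ChangesPoly => n.
by rewrite -kk' /= rmorph_int.
Qed.

(** The coefficients come from the inverse of an integer matrix, and matrix inversion commutes with
    field morphisms. *)
Lemma rmorph_coefs n i : iota (coefs R n i) = coefs F n i.
Proof.
rewrite /coefs; case: (ltnP i (3 ^ n)) => h; last first.
  by rewrite !nth_default ?rmorph0 // size_map size_enum_ord.
rewrite !(nth_map (Ordinal h)) -?enumT ?size_enum_ord // !castmxE.
have -> : map_mx (intr : int -> F) (ctmat n) =
    map_mx iota (map_mx (intr : int -> R) (ctmat n)).
  by apply/matrixP => a b; rewrite !mxE rmorph_int.
by rewrite -map_invmx [RHS]mxE.
Qed.

Lemma qmap_Coefs n i : mt (Coefs R n i) = Coefs F n i.
Proof.
case: n => [|[|n]] /=; congr qe_rcf.Const.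
- by rewrite rmorph_nat.
- by case: i => [|[|[|i]]]; rewrite /= ?nth_nil ?fmorphV ?rmorph_nat ?rmorph0.
- exact: rmorph_coefs.
Qed.

Lemma qmap_CcountWeak p sq k k' : (forall x, k' (mt x) = mf (k x)) ->
  CcountWeak (mp p) (map mp sq) k' = mf (CcountWeak p sq k).
Proof.
move=> kk'; rewrite /CcountWeak !size_map.
rewrite -[qe_rcf.NatConst F 0]/(mt (qe_rcf.NatConst R 0)).
elim: (3 ^ _)%N (qe_rcf.NatConst R 0) => [|n IH] s //=.
by apply: qmap_TaqsR => x; rewrite -IH -qmap_Coefs.
Qed.

Lemma qmap_BoundingPoly sq : BoundingPoly (map mp sq) = mp (BoundingPoly sq).
Proof.
rewrite /BoundingPoly -qmap_Deriv; congr Deriv.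
by elim: sq => //= p sq IH; rewrite IH qmap_MulPoly.
Qed.

Lemma qmap_CcountGt0 sp sq :
  CcountGt0 (map mp sp) (map mp sq) = mf (CcountGt0 sp sq).
Proof.
apply: qmap_BigRgcd => p; apply: qmap_Isnull => -[] /=; last first.
  by apply: qmap_CcountWeak.
(* Without a nonzero equation, solutions of the strict inequalities are sought at the critical
   points of the product of their polynomials and near plus and minus infinity. *)
rewrite /bind_def qmap_BoundingPoly; apply: qmap_CcountWeak => cw /=.
rewrite /reducebig; congr (qe_rcf.Or _ (qe_rcf.Or _ _)).
  by elim: (sq) => //= q s ->; congr qe_rcf.And; apply: qmap_LeadCoef.
elim: (sq) => //= q s ->; congr qe_rcf.And.
by apply: qmap_Size => n; apply: qmap_LeadCoef.
Qed.

Lemma qmap_abstrX i t : abstrX i (mt t) = mp (abstrX i t).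
Proof.
elim: t => //=.
- by move=> n; case: eqP.
- by move=> t1 -> t2 ->; rewrite qmap_AddPoly.
- by move=> t ->; rewrite qmap_OppPoly.
- by move=> t -> n; rewrite qmap_NatMulPoly.
- by move=> t1 -> t2 ->; rewrite qmap_MulPoly.
- by move=> t -> n; rewrite qmap_ExpPoly.
Qed.

Local Notation MT := (map_term iota).
Local Notation MF := (map_formula iota).

(** [wproj] eliminates one existential quantifier in front of a system of equations and strict
    inequalities. It is the only part of the elimination that computes with coefficients. *)
Lemma map_wproj n s :
  MF (wproj n s) = wproj n (map MT s.1%PAIR, map MT s.2%PAIR).
Proof.
rewrite map_formula_of_qf /wproj -qmap_CcountGt0 -!map_comp /=.
by congr CcountGt0; apply: eq_map => t /=; rewrite to_rterm_map_term qmap_abstrX.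
Qed.

(** * Disjunctive normal forms and the elimination of all quantifiers *)

Definition map_oclause (c : ord.oclause R) : ord.oclause F :=
  let: ord.Oclause a b c d := c in
  ord.Oclause (map MT a) (map MT b) (map MT c) (map MT d).

Lemma map_leq_elim_aux a b c :
  ord.leq_elim_aux (map MT a) (map MT b) (map MT c) =
  [seq (map MT x.1%PAIR, map MT x.2%PAIR) | x <- ord.leq_elim_aux a b c].
Proof.
elim: c => //= t c ->; rewrite map_cat -!map_comp.
by congr (_ ++ _); apply: eq_map.
Qed.

Lemma map_neq_elim_aux a b :
  ord.neq_elim_aux (map MT a) (map MT b) = map (map MT) (ord.neq_elim_aux a b).
Proof.
elim: b => //= t b ->; rewrite map_cat -!map_comp.
by congr (_ ++ _); apply: eq_map.
Qed.

Lemma map_oclause_to_w c : ord.oclause_to_w (map_oclause c) =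
  [seq (map MT x.1%PAIR, map MT x.2%PAIR) | x <- ord.oclause_to_w c].
Proof.
rewrite /ord.oclause_to_w /ord.oclause_neq_leq_elim !map_flatten -!map_comp.
congr flatten; case: c => a b c d /=.
rewrite map_leq_elim_aux -!map_comp; apply: eq_map => -[u v] /=.
rewrite map_neq_elim_aux -!map_comp; exact: eq_map.
Qed.

Lemma map_and_odnf c1 c2 :
  ord.and_odnf (map map_oclause c1) (map map_oclause c2) =
  map map_oclause (ord.and_odnf c1 c2).
Proof.
rewrite /ord.and_odnf big_map; elim: c1 => [|x c1 IH]; first by rewrite !big_nil.
rewrite !big_cons map_cat IH -!map_comp; congr (_ ++ _).
by apply: eq_map; case: x => ? ? ? ? [] ? ? ? ? /=; rewrite !map_cat.
Qed.

Lemma map_qf_to_odnf f b :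
  ord.qf_to_odnf (MF f) b = map map_oclause (ord.qf_to_odnf f b).
Proof.
elim: f b => //=; try (by move=> ? ? []); try (by move=> ? []);
  try (by move=> ? ? ? []).
- by move=> b c; case: ifP.
- by move=> f IHf g IHg []; rewrite IHf IHg ?map_cat ?map_and_odnf.
- by move=> f IHf g IHg []; rewrite IHf IHg ?map_cat ?map_and_odnf.
- by move=> f IHf g IHg []; rewrite IHf IHg ?map_cat ?map_and_odnf.
Qed.

Lemma map_proj n c :
  ord.proj (@wproj F) n (map_oclause c) = MF (ord.proj (@wproj R) n c).
Proof.
rewrite /ord.proj map_oclause_to_w -map_comp; elim: ord.oclause_to_w => //= x s ->.
by rewrite map_wproj.
Qed.

(** The procedure is uniform in the field: outside the projections, handled by [map_proj], it only
    rearranges formulas. *)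
Lemma map_quantifier_elim f : MF (ord.quantifier_elim (@wproj R) f) =
  ord.quantifier_elim (@wproj F) (MF f).
Proof.
have D n cs : foldr ord.Or (ord.Bool false)
    [seq ord.proj (@wproj F) n i | i <- map map_oclause cs] =
    MF (foldr ord.Or (ord.Bool false) [seq ord.proj (@wproj R) n i | i <- cs]).
  by elim: cs => //= c cs ->; rewrite map_proj.
elim: f => //=; try by move=> *; congruence.
- by move=> n f <-; rewrite map_qf_to_odnf D.
- by move=> n f <-; rewrite map_qf_to_odnf D.
Qed.

Lemma rterm_map_term t : GRing.rterm (MT t) = GRing.rterm t.
Proof. by elim: t => //= *; congruence. Qed.

Lemma rformula_map_formula f : ord.rformula (MF f) = ord.rformula f.
Proof. by elim: f => //= *; rewrite ?rterm_map_term //; congruence. Qed.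

Lemma qf_form_map_formula f : ord.qf_form (MF f) = ord.qf_form f.
Proof. by elim: f => //= *; congruence. Qed.

(** In a real closed field the nonnegative elements are the squares, so a ring morphism cannot fail
    to preserve the order. *)
Lemma rmorph_ge0 x : (0 <= iota x) = (0 <= x).
Proof.
have H y : 0 <= y -> 0 <= iota y.
  by move=> y0; rewrite -(sqr_sqrtr y0) rmorphXn sqr_ge0.
case: (leP 0 x) => [/H//|x0]; apply/negbTE; rewrite -ltNge lt_neqAle fmorph_eq0.
rewrite lt_eqF //= -oppr_ge0 -rmorphN; apply: H.
by rewrite oppr_ge0 ltW.
Qed.

Lemma rmorph_ler x y : (iota x <= iota y) = (x <= y).
Proof. by rewrite -subr_ge0 -rmorphB rmorph_ge0 subr_ge0. Qed.

Lemma rmorph_ltr x y : (iota x < iota y) = (x < y).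
Proof. by rewrite !ltNge rmorph_ler. Qed.

Lemma eval_map_term e t :
  GRing.eval (map iota e) (MT t) = iota (GRing.eval e t).
Proof.
elim: t => //=.
- move=> i; case: (ltnP i (size e)) => h; first by rewrite (nth_map 0).
  by rewrite !nth_default ?rmorph0 ?size_map.
- by move=> n; rewrite rmorph_nat.
- by move=> ? -> ? ->; rewrite rmorphD.
- by move=> ? ->; rewrite rmorphN.
- by move=> ? -> n; rewrite rmorphMn.
- by move=> ? -> ? ->; rewrite rmorphM.
- by move=> ? ->; rewrite fmorphV.
- by move=> ? -> n; rewrite rmorphXn.
Qed.

Lemma qf_holds_map_formula e f : ord.qf_form f ->
  (ord.holds (map iota e) (MF f) <-> ord.holds e f).
Proof.
elim: f => //=; try by move=> *; rewrite !eval_map_term ?rmorph_ler ?rmorph_ltr.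
- by move=> t1 t2 _; rewrite !eval_map_term; split=> [/fmorph_inj|->].
- by move=> t _; rewrite eval_map_term !unitfE fmorph_eq0.
- by move=> f1 h1 f2 h2 /andP[/h1 {}h1 /h2 {}h2]; tauto.
- by move=> f1 h1 f2 h2 /andP[/h1 {}h1 /h2 {}h2]; tauto.
- by move=> f1 h1 f2 h2 /andP[/h1 {}h1 /h2 {}h2]; tauto.
- by move=> f1 h1 /h1 {}h1; tauto.
Qed.

(** Over both fields the formula is equivalent to one and the same quantifier-free formula, up to
    [iota], and [iota] preserves and reflects the truth of the latter. *)
Theorem holds_map_formula e f : ord.rformula f ->
  (ord.holds (map iota e) (MF f) <-> ord.holds e f).
Proof.
move=> rf; have Q (K : rcfType) (e' : seq K) g : ord.rformula g ->
    ord.holds e' g <-> ord.holds e' (ord.quantifier_elim (@wproj K) g).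
  move=> rg; have /andP[qg _] := ord.quantifier_elim_wf (@wf_QE_wproj K) rg.
  have P := ord.quantifier_elim_rformP (@wf_QE_wproj K) (@valid_QE_wproj K) e' rg.
  by split=> [/P/(ord.qf_evalP _ qg)|/(ord.qf_evalP _ qg)/P].
have /andP[qf _] := ord.quantifier_elim_wf (@wf_QE_wproj R) rf.
rewrite (Q F) ?rformula_map_formula // (Q R) // -map_quantifier_elim.
exact: qf_holds_map_formula.
Qed.

End Transfer.

(** * Growth of definable functions of one variable *)

Section PolynomialGrowth.
Variable R : rcfType.

Lemma poly_away0 (p : {poly R}) : p != 0 ->
  exists s T d : R, [/\ `|s| = 1, 0 < d & forall t, T <= t -> d <= s * p.[t]].
Proof.
elim/poly_ind: p => [|p c IH]; first by rewrite eqxx.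
have [->|p0 _] := eqVneq p 0.
  rewrite mul0r add0r polyC_eq0 => c0.
  exists (Num.sg c), 0, `|c|; rewrite normr_sg c0 normr_gt0 c0; split=> // t _.
  by rewrite hornerC -normrEsg.
have [s [T [d [s1 d0 sp]]]] := IH p0.
(* From 1 + |c| / d on, d * t is at least d + |c|, so adding [c] cannot push the value below [d]. *)
exists s, (Num.max T (1 + `|c| / d)), d; split=> // t; rewrite ge_max => /andP[/sp h1 h2].
rewrite !hornerE mulrDr mulrA.
have h3 : - `|c| <= s * c by rewrite -[`|c|]mul1r -s1 -normrM lerNl -normrN ler_norm.
have h4 : d + `|c| <= d * t.
  apply: le_trans (ler_wpM2l (ltW d0) h2).
  by rewrite mulrDr mulr1 mulrCA mulfV ?gt_eqF // mulr1.
have t0 : 0 <= t by apply: le_trans h2; rewrite addr_ge0 ?divr_ge0 // ltW.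
have := lerD (le_trans h4 (ler_wpM2r t0 h1)) h3.
by rewrite addrK.
Qed.

Lemma poly_pow_bound (p : {poly R}) :
  exists k (T : R), forall t, T <= t -> `|p.[t]| <= t ^+ k.
Proof.
elim/poly_ind: p => [|p c [k [T IH]]].
  by exists 0%N, 0 => t _; rewrite horner0 normr0 expr0.
(* The factor [t] raises the exponent once; the sum of two terms bounded by [t ^+ k.+1] costs a
   factor 2, which is at most [t]. *)
exists k.+2, (Num.max T (Num.max 2 `|c|)) => t; rewrite !ge_max => /and3P[/IH h1 h2 h3].
have t0 : 0 <= t by apply: le_trans h2.
have t1 : 1 <= t by apply: le_trans h2; rewrite ler1n.
rewrite !hornerE; apply: le_trans (ler_normD _ _) _; rewrite normrM (ger0_norm t0).
have h4 : `|p.[t]| * t <= t ^+ k.+1 by rewrite exprSr ler_wpM2r.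
have h5 : `|c| <= t ^+ k.+1.
  by apply: le_trans h3 _; rewrite exprS ler_peMr // exprn_ege1.
apply: le_trans (lerD h4 h5) _; rewrite -mulr2n -mulr_natl [leRHS]exprS.
by rewrite ler_wpM2r ?exprn_ge0.
Qed.

(* Far out in the region v >= t ^+ k the leading term in v dominates. *)
Lemma bipoly_sign (q : {poly {poly R}}) : q != 0 ->
  exists k (s T : R), `|s| = 1 /\
    forall t v, T <= t -> t ^+ k <= v -> 1 <= t ^+ k * (s * q.[v%:P].[t]).
Proof.
elim/poly_ind: q => [|q c IH]; first by rewrite eqxx.
have [->|q0 _] := eqVneq q 0.
  rewrite mul0r add0r polyC_eq0 => /poly_away0[s [T [d [s1 d0 sc]]]].
  (* The polynomial is constant in [v] and eventually at least [d] up to sign; one factor t >= 1/d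
     lifts this to 1. *)
  exists 1%N, s, (Num.max T d^-1); split=> // t v.
  rewrite ge_max => /andP[/sc h1 h2] _; rewrite hornerC expr1.
  have t0 : 0 <= t by apply: le_trans h2; rewrite invr_ge0 ltW.
  apply: le_trans (ler_wpM2l t0 h1); rewrite -(mulVf (lt0r_neq0 d0)).
  by rewrite ler_wpM2r // ltW.
have [k [s [T [s1 sq]]]] := IH q0.
have [l [T' sc]] := poly_pow_bound c.
(* By induction [s * Q] is at least [t ^- k], so [s * Q * v] is at least [t ^+ l.+1]. For t >= 2
   this exceeds the bound [t ^+ l] of the constant term by at least 1. *)
exists (k + l).+1, s, (Num.max T (Num.max T' 2)); split=> // t v.
rewrite !ge_max => /and3P[Tt /sc h1 t2] vt.
have t0 : 0 <= t by apply: le_trans t2.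
have t1 : 1 <= t by apply: le_trans t2; rewrite ler1n.
have vk : t ^+ k <= v.
  apply: le_trans vt; rewrite -addnS exprD ler_peMr ?exprn_ge0 ?exprn_ege1 //.
have h2 := sq t v Tt vk; rewrite !hornerE.
set Q := q.[_].[t] in h2 *; set C := c.[t] in h1 *.
have tk m : 0 <= t ^+ m by rewrite exprn_ge0.
have tk1 m : 1 <= t ^+ m by rewrite exprn_ege1.
have h3 : - t ^+ l <= s * C.
  by rewrite lerNl; apply: le_trans h1; rewrite -[leRHS]mul1r -s1 -normrM -normrN ler_norm.
have sQ : 0 <= s * Q.
  have tk0 : 0 < t ^+ k by apply: lt_le_trans (tk1 k).
  by rewrite -(pmulr_rge0 _ tk0); apply: le_trans h2.
have h4 : t ^+ l.+1 <= s * Q * v.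
  apply: le_trans (ler_wpM2l sQ vt); rewrite -addnS exprD mulrA [_ * t ^+ k]mulrC.
  by rewrite ler_peMl.
have h5 : 1 <= s * (Q * v + C).
  rewrite mulrDr mulrA; apply: le_trans (lerD h4 h3).
  rewrite exprS -{2}[t ^+ l]mul1r -mulrBl -[leLHS]mulr1 ler_pM //.
  by rewrite lerBrDr.
by apply: (le_trans (h5)); rewrite /= -mulrA ler_peMl // (le_trans _ h5).
Qed.

Lemma bipoly_sg (q : {poly {poly R}}) : exists k (T : R), forall t u v, T <= t ->
  t ^+ k <= u -> t ^+ k <= v -> Num.sg q.[u%:P].[t] = Num.sg q.[v%:P].[t].
Proof.
have [->|/bipoly_sign[k [s [T [s1 sq]]]]] := eqVneq q 0.
  by exists 0%N, 0 => *; rewrite !horner0.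
exists k, (Num.max T 1) => t u v; rewrite ge_max => /andP[Tt t1] tu tv.
have tk : 0 < t ^+ k by rewrite exprn_gt0 // (lt_le_trans ltr01).
have s0 : Num.sg s != 0 by rewrite sgr_eq0 -normr_eq0 s1 oner_eq0.
have sgq w : t ^+ k <= w -> Num.sg s * Num.sg q.[w%:P].[t] = 1.
  move=> /(sq _ _ Tt)/(lt_le_trans ltr01); rewrite pmulr_rgt0 // => h.
  by rewrite -sgrM gtr0_sg.
by apply: (mulfI s0); rewrite !sgq.
Qed.

Lemma eval_term2 (tm : GRing.term R) : GRing.rterm tm ->
  exists q : {poly {poly R}}, forall t v,
    GRing.eval [:: t; v] tm = q.[v%:P].[t].
Proof.
elim: tm => //=.
- move=> [|[|i]] _; first by exists 'X%:P => t v; rewrite hornerC hornerX.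
    by exists 'X => t v; rewrite hornerX hornerC.
  by exists 0 => t v; rewrite !horner0 nth_default.
- by move=> c _; exists c%:P%:P => t v; rewrite !hornerC.
- by move=> n _; exists (n%:R)%:P%:P => t v; rewrite !hornerC.
- move=> t1 h1 t2 h2 /andP[/h1[p pE] /h2[q qE]].
  by exists (p + q) => t v; rewrite !hornerD pE qE.
- by move=> t1 h1 /h1[p pE]; exists (- p) => t v; rewrite !hornerN pE.
- by move=> t1 h1 n /h1[p pE]; exists (p *+ n) => t v; rewrite !hornerMn pE.
- move=> t1 h1 t2 h2 /andP[/h1[p pE] /h2[q qE]].
  by exists (p * q) => t v; rewrite !hornerM pE qE.
- by move=> t1 h1 n /h1[p pE]; exists (p ^+ n) => t v; rewrite !horner_exp pE.
Qed.

Definition asymptotic (Q : R -> R -> R -> Prop) := exists k (T : R),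
  forall t u v, T <= t -> t ^+ k <= u -> t ^+ k <= v -> Q t u v.

Lemma asymptoticI (P Q S : R -> R -> R -> Prop) :
  asymptotic P -> asymptotic Q ->
  (forall t u v, P t u v -> Q t u v -> S t u v) -> asymptotic S.
Proof.
move=> [k [T PT]] [l [T' QT]] PQS; exists (k + l)%N, (Num.max 1 (Num.max T T')).
move=> t u v; rewrite !ge_max => /and3P[t1 Tt T't] tu tv.
have [tk tl] : t ^+ k <= t ^+ (k + l) /\ t ^+ l <= t ^+ (k + l).
  by split; apply: ler_weXn2l; rewrite ?leq_addr ?leq_addl.
by apply: PQS; [apply: PT | apply: QT]; rewrite // (le_trans _ tu, le_trans _ tv).
Qed.

(** Each of the finitely many polynomials in [f] has a constant sign in the second variable above
    some power of the first. Hence the boundary of a semialgebraic subset of the plane stays, for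
    large [t], below a power curve or on it. *)
Lemma formula_asymptotic (f : ord.formula R) : sign_formula f ->
  asymptotic (fun t u v => ord.holds [:: t; u] f <-> ord.holds [:: t; v] f).
Proof.
have sgq (q : {poly {poly R}}) P :
    (forall t u v, Num.sg q.[u%:P].[t] = Num.sg q.[v%:P].[t] -> P t u v) ->
    asymptotic P.
  by move=> h; have [k [T H]] := bipoly_sg q; exists k, T => *; apply/h/H.
rewrite /sign_formula; elim: f => //=.
- by move=> b _; exists 0%N, 0.
- move=> t1 t2 /andP[/eval_term2[p pE] /eval_term2[q qE]].
  apply: (sgq (p - q)) => t u v; rewrite !pE !qE !hornerE => E.
  by rewrite !(rwP eqP) -!(subr_eq0 p.[_].[_]) -sgr_eq0 E sgr_eq0.
- move=> t1 t2 /andP[/eval_term2[p pE] /eval_term2[q qE]].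
  apply: (sgq (p - q)) => t u v; rewrite !pE !qE !hornerE => E.
  by rewrite -!(subr_lt0 q.[_].[_]) -sgr_lt0 E sgr_lt0.
- move=> t1 t2 /andP[/eval_term2[p pE] /eval_term2[q qE]].
  apply: (sgq (p - q)) => t u v; rewrite !pE !qE !hornerE => E.
  by rewrite -!(subr_le0 q.[_].[_]) -sgr_le0 E sgr_le0.
- move=> f1 h1 f2 h2 /andP[/andP[q1 q2] /andP[r1 r2]].
  move: h1 h2; rewrite q1 q2 => /(_ r1) h1 /(_ r2) h2.
  by apply: asymptoticI h1 h2 _ => t u v; tauto.
- move=> f1 h1 f2 h2 /andP[/andP[q1 q2] /andP[r1 r2]].
  move: h1 h2; rewrite q1 q2 => /(_ r1) h1 /(_ r2) h2.
  by apply: asymptoticI h1 h2 _ => t u v; tauto.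
- move=> f1 h1 f2 h2 /andP[/andP[q1 q2] /andP[r1 r2]].
  move: h1 h2; rewrite q1 q2 => /(_ r1) h1 /(_ r2) h2.
  by apply: asymptoticI h1 h2 _ => t u v; tauto.
- move=> f1 h1 /h1[k [T H]]; exists k, T => t u v Tt tu tv.
  by have := H t u v Tt tu tv; tauto.
Qed.

(** This is the polynomial growth of definable functions: a threshold for [v] that depends definably
    on [t] can be replaced by a power of [t]. It supplies the exponent in Lojasiewicz's
    inequality. *)
Lemma definable_pow_growth (W : R -> R -> Prop) :
  definable 2 (fun e : seq R => W (nth 0 e 0) (nth 0 e 1)) ->
  (forall t, 0 < t -> exists v0, forall v, v0 <= v -> W t v) ->
  exists k (T : R), 0 < T /\ forall t, T <= t -> W t (t ^+ k).
Proof.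
move=> [f fW] Wv; have [g gs gf] := qe_formula f.
have [k [T gk]] := formula_asymptotic gs.
exists k, (Num.max 1 T); split=> [|t]; first by rewrite lt_max ltr01.
rewrite ge_max => /andP[t1 Tt].
have [v0 vW] := Wv t (lt_le_trans ltr01 t1).
(* At this [v] the relation holds, and between [t ^+ k] and [v] its truth value does not change. *)
pose v := Num.max v0 (t ^+ k).
have /vW/(fW [:: t; v] erefl)/gf gv : v0 <= v by rewrite le_max lexx.
have tv : t ^+ k <= v by rewrite le_max lexx orbT.
by apply/(fW [:: t; t ^+ k] erefl)/gf/(gk t _ _ Tt (lexx _) tv).
Qed.

End PolynomialGrowth.

(** * Homomorphisms on closed and bounded sets *)

(** With u, v >= 0 the square of |u - v| is at most |u - v| (u + v) = |u^2 - v^2|, so a tolerance of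
    [e * e] for [f] suffices. *)
Lemma continuous_sqrtr (R : rcfType) (T : topologicalType) (f : T -> R) : continuous f -> (forall x, 0 <= f x) ->
  continuous (fun x => Num.sqrt (f x)).
Proof.
move=> cf f0 x; apply/cvgrPdist_lt => e e0.
have /cvgrPdist_lt/(_ (e * e)) := cf x; rewrite mulr_gt0 // => /(_ isT).
apply: filterS => y; apply: contraTT; rewrite -!leNgt => h.
have := ler_pM (ltW e0) (ltW e0) h h; move/le_trans; apply.
set u := Num.sqrt (f x); set v := Num.sqrt (f y).
have u0 : 0 <= u by apply: sqrtr_ge0.
have v0 : 0 <= v by apply: sqrtr_ge0.
rewrite -(sqr_sqrtr (f0 x)) -(sqr_sqrtr (f0 y)) -/u -/v subr_sqr normrM.
rewrite ler_wpM2l // [leRHS]ger0_norm ?addr_ge0 // ler_norml.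
by rewrite opprD lerD2r lerD2l (ge0_cp u0) (ge0_cp v0).
Qed.

Section ClosedBounded.
Variables (R : rcfType) (m : nat) (X : sa_set R m).
Hypotheses (X_closed : closed X) (X_bounded : bounded_set X).
Local Notation S := (sa_ring false X).

Lemma sa_ring_cont (a : S) : continuous (sa_val a).
Proof. by have /semialg_funP[] := sa_valP a. Qed.

Lemma sa_ring_graph (a : S) : semialgebraic (Defs.fgraph (sa_val a)).
Proof. by have /semialg_funP[] := sa_valP a. Qed.

Lemma sa_ringD (a b : S) (x : X) : (a + b) x = a x + b x. Proof. by []. Qed.
Lemma sa_ringN (a : S) (x : X) : (- a) x = - a x. Proof. by []. Qed.
Lemma sa_ringM (a b : S) (x : X) : (a * b) x = a x * b x. Proof. by []. Qed.
Lemma sa_ring1 (x : X) : (1 : S) x = 1. Proof. by []. Qed.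

Lemma sa_ring_ext (a b : S) : (forall x, a x = b x) -> a = b.
Proof. by move=> ab; apply/val_inj/funext. Qed.

Lemma sa_ringMn (a : S) n (x : X) : (a *+ n) x = a x *+ n.
Proof. by elim: n => // n IH; rewrite !mulrS sa_ringD IH. Qed.

Lemma sa_ringXn (a : S) n (x : X) : (a ^+ n) x = a x ^+ n.
Proof. by elim: n => [|n IH]; rewrite ?expr0 // !exprS sa_ringM IH. Qed.

Lemma sa_ring_sum (I : Type) (r : seq I) (G : I -> S) (x : X) :
  (\sum_(i <- r) G i) x = \sum_(i <- r) G i x.
Proof. by elim: r => [|i r IH]; rewrite ?big_nil // !big_cons sa_ringD IH. Qed.

Lemma sa_ring_prod (I : Type) (r : seq I) (G : I -> S) (x : X) :
  (\prod_(i <- r) G i) x = \prod_(i <- r) G i x.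
Proof. by elim: r => [|i r IH]; rewrite ?big_nil // !big_cons sa_ringM IH. Qed.

Lemma sa_sqrt (a : S) : (forall x, 0 <= a x) ->
  exists b : S, forall x, b x = Num.sqrt (a x).
Proof.
move=> a0; suff h : (fun x => Num.sqrt (a x)) \in semialg_fun false X.
  by exists (SaRing h).
apply/semialg_funP; split=> //; first exact: continuous_sqrtr (@sa_ring_cont a) a0.
apply: (sa_graph_op2 (h := fun u v => Num.sqrt u)) (sa_ring_graph a) (sa_ring_graph a).
pose V := GRing.Var R.
(* [Num.sqrt] is 0 on negative numbers, and its graph has to be described there as well. The second
   argument of the binary operation is a dummy. *)
have := def_and (def_le 3 (GRing.NatConst R 0) (V 0%N))
  (def_and (def_imp (def_le 3 (GRing.NatConst R 0) (V 1%N))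
                    (def_eq 3 (GRing.Exp (V 0%N) 2) (V 1%N)))
           (def_imp (def_lt 3 (V 1%N) (GRing.NatConst R 0))
                    (def_eq 3 (V 0%N) (GRing.NatConst R 0)))).
apply: def_ext => e _ /=; split=> [[z0 [h1 h2]]|->].
  have [u0|u0] := leP 0 (nth 0 e 1); last by rewrite h2 // ltr0_sqrtr.
  by rewrite -h1 // sqrtr_sqr ger0_norm.
rewrite sqrtr_ge0; split=> //; split=> [u0|u0]; first by rewrite sqr_sqrtr.
by rewrite ltr0_sqrtr.
Qed.

Lemma sa_inv (a : S) : (forall x, a x != 0) ->
  exists b : S, forall x, b x = (a x)^-1.
Proof.
move=> a0; suff h : (fun x => (a x)^-1) \in semialg_fun false X.
  by exists (SaRing h).
apply/semialg_funP; split=> //.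
  by move=> x; exact: (cvgV (a0 x) (@sa_ring_cont a x)).
apply: (sa_graph_op2 (h := fun u v => u^-1)) (sa_ring_graph a) (sa_ring_graph a).
exact: (def_eq 3 (GRing.Var R 0) (GRing.Inv (GRing.Var R 1))).
Qed.

Lemma sa_ring_bounded (a : S) : exists B, 0 < B /\ forall x, `|a x| <= B.
Proof.
have /Defs.bounded_funP[B aB] :=
  sa_bounded X_closed X_bounded (@sa_ring_cont a) (sa_ring_graph a).
exists (Num.max 1 B); rewrite lt_max ltr01; split=> // x.
by rewrite le_max aB orbT.
Qed.

Lemma sa_abs (a : S) : exists b : S, forall x, b x = `|a x|.
Proof.
have [|b ab] := @sa_sqrt (a ^+ 2).
  by move=> x; rewrite sa_ringXn sqr_ge0.
by exists b => x; rewrite ab sa_ringXn sqrtr_sqr.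
Qed.

(** * Lojasiewicz's inequality on a closed and bounded set *)

Lemma levelset_definable (g h : S) : definable 2 (fun e : seq R =>
  forall x : X, 1 <= nth 0 e 0 * g x -> 1 <= nth 0 e 1 * h x).
Proof.
have /semialgebraicP dg := sa_ring_graph g.
have /semialgebraicP dh := sa_ring_graph h.
pose V := GRing.Var R.
(* Variables 0 and 1 are [t] and [v], the next [m] are the coordinates of a point, and the last two
   are the values of [g] and [h] there. *)
pose tg := vars R 2 m ++ [:: V m.+2]; pose th := vars R 2 m ++ [:: V m.+3].
have stg : size tg = (m + 1)%N by rewrite size_cat size_vars.
have sth : size th = (m + 1)%N by rewrite size_cat size_vars.
have := def_imp (def_inst (2 + (m + 2)) stg dg)
 (def_imp (def_inst (2 + (m + 2)) sth dh)
  (def_imp (def_le (2 + (m + 2)) (GRing.NatConst R 1) (GRing.Mul (V 0%N) (V m.+2)))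
           (def_le (2 + (m + 2)) (GRing.NatConst R 1) (GRing.Mul (V 1%N) (V m.+3))))).
move=> /def_all; apply: def_ext => -[|t [|v []]] //= _.
have E (x : seq R) y z : size x = m -> [/\
    map (GRing.eval [:: t, v & x ++ [:: y; z]]) tg = x ++ [:: y],
    map (GRing.eval [:: t, v & x ++ [:: y; z]]) th = x ++ [:: z],
    nth 0 (x ++ [:: y; z]) m = y & nth 0 (x ++ [:: y; z]) m.+1 = z].
  move=> sx; have N1 : nth 0 (x ++ [:: y; z]) m = y by rewrite nth_cat sx ltnn subnn.
  have N2 : nth 0 (x ++ [:: y; z]) m.+1 = z.
    by rewrite nth_cat sx ltnNge leqnSn /= subSnn.
  have Vx : map (GRing.eval [:: t, v & x ++ [:: y; z]]) (vars R 2 m) = x.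
    exact: (@eval_vars R [:: t; v] x [:: y; z]).
  by rewrite /tg /th !map_cat Vx /= N1 N2.
split=> H.
  move=> x; have [E1 E2 E3 E4] := E (env (val x)) (g x) (h x) (size_env _).
  have := H (env (val x) ++ [:: g x; h x]).
  rewrite E1 E2 E3 E4 size_cat size_env => /(_ erefl); apply.
    by apply/fgraphP; rewrite ?size_env //; exists x.
  by apply/fgraphP; rewrite ?size_env //; exists x.
move=> s /split_size[x [yz [-> sx]]]; case: yz => [|y [|z []]] // _.
have [-> -> -> ->] := E x y z sx; rewrite !fgraphP //.
move=> [x1 [x1x <-]] [x2 [x2x <-]].
have -> : x2 = x1 by apply: env_inj; rewrite x1x x2x.
exact: H.
Qed.

(** Since [h] has no zero where [1 <= t * g], it agrees there with a function that has no zero on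
    all of X. The inverse of that function lies in S(X) and is therefore bounded, and its bound
    serves as [v0]. *)
Lemma levelset_bound (g h : S) (t : R) : (forall x, 0 <= h x) ->
  (forall x, h x = 0 -> g x = 0) ->
  exists v0, forall v, v0 <= v -> forall x, 1 <= t * g x -> 1 <= v * h x.
Proof.
move=> h0 hg; have [b bE] := sa_abs (1 - sa_cst false X t * g).
have bx x : b x = `|1 - t * g x| by rewrite bE.
(* This function equals h where 1 <= t * g, and has no zero on X. *)
have [|d dE] := @sa_inv (h + b + (1 - sa_cst false X t * g)).
  move=> x; rewrite !sa_ringD sa_ringN sa_ringM sa_ring1 bx /=; apply/eqP => E.
  have N : 0 <= `|1 - t * g x| + (1 - t * g x).
    by rewrite addrC -lerBlDl sub0r ler_normr lexx orbT.
  have hx : h x = 0.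
    by apply/eqP; rewrite eq_le h0 andbT -E -addrA lerDl.
  by move: E; rewrite hx hg // mulr0 subr0 normr1 add0r => /eqP; rewrite (pnatr_eq0 _ 2).
have [B [B0 dB]] := sa_ring_bounded d; exists B => v Bv x tg.
have := dB x; rewrite dE !sa_ringD sa_ringN sa_ringM sa_ring1 bx /=.
have tg0 : 1 - t * g x <= 0 by rewrite subr_le0.
rewrite (ler0_norm tg0) subrK => hB.
have hx : 0 < h x.
  rewrite lt_neqAle h0 andbT eq_sym; apply/eqP => /hg gx.
  by move: tg; rewrite gx mulr0 ler10.
rewrite -ler_pdivrMr // div1r; apply: le_trans Bv; apply: le_trans hB.
exact: ler_norm.
Qed.

(** For t, v > 0 the relation between [t] and [v] says that h >= 1/v wherever g >= 1/t. Polynomial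
    growth allows v = t^k for large [t], and t = 1/g(x) then gives g(x)^k <= h(x) where [g] is small
    and positive. *)
Lemma lojasiewicz (g h : S) : (forall x, 0 <= g x) -> (forall x, 0 <= h x) ->
  (forall x, h x = 0 -> g x = 0) ->
  exists k C, forall x, g x ^+ k <= C * h x.
Proof.
move=> g0 h0 hg.
have [||k [T [T0 W]]] := @definable_pow_growth R
  (fun t v => forall x : X, 1 <= t * g x -> 1 <= v * h x).
- exact: levelset_definable.
- by move=> t t0; apply: levelset_bound.
have [G [G0 gG]] := sa_ring_bounded g.
(* The first summand serves where g >= 1/T, since there T^k h >= 1; the second serves where 0 < g <
   1/T, since there g^k <= h. With [k.+1] in place of [k] the left side vanishes at the zeros of [g]
   even if [k] is 0. *)
exists k.+1, (G ^+ k.+1 * T ^+ k + G) => x.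
have gGx : g x <= G by apply: le_trans (ler_norm _) (gG x).
have [->|gx] := eqVneq (g x) 0.
  by rewrite expr0n /= mulr_ge0 ?addr_ge0 ?mulr_ge0 ?exprn_ge0 // ltW.
have gx0 : 0 < g x by rewrite lt_neqAle eq_sym gx g0.
rewrite mulrDl; have [h1|h1] := leP 1 (T * g x).
  have h2 := W T (lexx _) x h1; apply: (@le_trans _ _ (G ^+ k.+1 * T ^+ k * h x)).
    apply: (@le_trans _ _ (G ^+ k.+1)); first by rewrite lerXn2r // nnegrE ltW.
    by rewrite -mulrA ler_peMr // exprn_ge0 // ltW.
  by rewrite lerDl mulr_ge0 // ltW.
have h2 : T <= (g x)^-1 by rewrite -[leRHS]mul1r ler_pdivlMr // ltW.
have := W _ h2 x; rewrite mulVf // => /(_ (lexx _)).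
rewrite exprVn ler_pdivlMl ?exprn_gt0 // mulr1 => h3.
apply: (@le_trans _ _ (G * h x)); first by rewrite exprS ler_pM ?exprn_ge0.
by rewrite lerDr !mulr_ge0 ?exprn_ge0 // ltW.
Qed.

(** * Sign conditions and their specialization under [psi] *)

Section Specialization.
Variables (F : rcfType) (iota : {rmorphism R -> F}) (psi : {rmorphism S -> F}).
Hypothesis psi_R : R_hom iota psi.

Lemma psi_ge0 (a : S) : (forall x, 0 <= a x) -> 0 <= psi a.
Proof.
move=> a0; have [b bE] := sa_sqrt a0.
have -> : a = b ^+ 2.
  by apply: sa_ring_ext => x; rewrite sa_ringXn bE sqr_sqrtr.
by rewrite rmorphXn sqr_ge0.
Qed.

(** The image of the absolute value is nonnegative and has the same square as [psi a]. *)
Lemma psi_abs_exists (a : S) : exists b : S,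
  (forall x, b x = `|a x|) /\ psi b = `|psi a|.
Proof.
have [b bE] := sa_abs a; exists b; split=> //.
have b0 : 0 <= psi b by apply: psi_ge0 => x; rewrite bE.
apply/eqP; rewrite -(eqrXn2 (n := 2)) // real_normK ?num_real // -!rmorphXn.
apply/eqP; congr (psi _); apply: sa_ring_ext => x.
by rewrite !sa_ringXn bE real_normK ?num_real.
Qed.

(** Let [h] be the sum of the squares of those [a] that [psi] kills, and let [g] be a product of
    nonnegative functions that is nonzero only where every other [a] has the sign of [psi a]. If no
    point realised all signs, [g] would vanish on the zeros of [h]; Lojasiewicz's inequality would
    then force psi g <= 0, whereas psi g > 0. *)
Lemma sg_specialization (L : seq S) : exists x : X,
  forall a, a \in L -> iota (Num.sg (a x)) = Num.sg (psi a).
Proof.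
apply: contrapT => nx.
have [pos posE] := choice psi_abs_exists.
pose c a := if 0 < psi a then a else - a.
(* Twice the positive part of [c a]. When [psi a] is nonzero, [u a] is nonzero exactly where [a] has
   the sign of [psi a], and its image under [psi] is positive. *)
pose u a := c a + pos a.
have absc a x : `|c a x| = `|a x| by rewrite /c; case: ifP => // _; rewrite normrN.
have u0 a x : 0 <= u a x.
  by rewrite sa_ringD (posE a).1 -absc addrC -lerBlDr sub0r ler_normr lexx orbT.
pose L1 := [seq a <- L | psi a != 0]; pose L0 := [seq a <- L | psi a == 0].
pose g := \prod_(a <- L1) u a; pose h := \sum_(a <- L0) a ^+ 2.
have h0 x : 0 <= h x.
  by rewrite sa_ring_sum sumr_ge0 // => a _; rewrite sa_ringXn sqr_ge0.
have g0 x : 0 <= g x by rewrite sa_ring_prod prodr_ge0.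
have [x /eqP hx|k [C gh]] := lojasiewicz g0 h0.
  (* A zero of [h] at which [g] does not vanish would realise all the signs. *)
  apply: contrapT => /eqP gx; apply: nx; exists x => a aL.
  have [a0|a0] := eqVneq (psi a) 0.
    rewrite a0 sgr0; move: hx; rewrite sa_ring_sum psumr_eq0; last first.
      by move=> b _; rewrite sa_ringXn sqr_ge0.
    move=> /allP/(_ a); rewrite mem_filter a0 eqxx aL sa_ringXn sqrf_eq0 /=.
    by move=> /(_ isT)/eqP ->; rewrite sgr0 rmorph0.
  have ux : u a x != 0.
    move: gx; rewrite sa_ring_prod prodf_seq_neq0 => /allP/(_ a).
    by rewrite mem_filter a0 aL => /(_ isT).
  have cx : 0 < c a x.
    rewrite ltNge; apply/negP => cx; move: ux.
    by rewrite sa_ringD (posE a).1 -absc (ler0_norm cx) subrr eqxx.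
  move: cx; rewrite /c; have [pa|pa|pa] := ltgtP (psi a) 0.
  - by rewrite sa_ringN oppr_gt0 => ax; rewrite !ltr0_sg // rmorphN rmorph1.
  - by move=> ax; rewrite !gtr0_sg // rmorph1.
  - by rewrite pa eqxx in a0.
have pg : 0 < psi g.
  rewrite rmorph_prod /L1 big_filter; apply: prodr_gt0 => a a0.
  rewrite rmorphD (posE a).2 ltr_wpDl ?normr_gt0 //.
  by rewrite /c; case: ltP => [/ltW//|pa]; rewrite rmorphN oppr_ge0.
have ph : psi h = 0.
  rewrite rmorph_sum /L0 big_filter big1 // => a /eqP a0.
  by rewrite rmorphXn a0 expr0n.
have : 0 <= psi (sa_cst false X C * h - g ^+ k).
  apply: psi_ge0 => x; rewrite sa_ringD sa_ringM sa_ringN sa_ringXn subr_ge0.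
  exact: gh.
by rewrite rmorphB rmorphM ph mulr0 sub0r rmorphXn oppr_ge0 leNgt exprn_gt0.
Qed.

(** [P] is a statement about the values of elements of S(X) at a point, and [Q] is meant to be the
    same statement about their images under [psi]. The list [L] collects the elements whose signs
    decide it. *)
Definition sgs_determine (P : (S -> R) -> Prop) (Q : Prop) :=
  exists L : seq S, forall x : X,
    (forall a, a \in L -> iota (Num.sg (a x)) = Num.sg (psi a)) ->
    (P (fun a => a x) <-> Q).

Lemma sgs_determineI P P' P'' Q Q' Q'' :
  sgs_determine P Q -> sgs_determine P' Q' ->
  (forall v, (P v <-> Q) -> (P' v <-> Q') -> (P'' v <-> Q'')) ->
  sgs_determine P'' Q''.
Proof.
move=> [L LP] [L' LP'] H; exists (L ++ L') => x xL; apply: H.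
  by apply: LP => a aL; apply: xL; rewrite mem_cat aL.
by apply: LP' => a aL; apply: xL; rewrite mem_cat aL orbT.
Qed.

(** A polynomial expression in elements of S(X) is again an element of S(X), and [psi] commutes with
    its evaluation because it is an R-homomorphism. *)
Lemma eval_term_sa (e : seq S) (t : GRing.term R) : GRing.rterm t ->
  exists b : S, (forall x, GRing.eval [seq a x | a : S <- e] t = b x) /\
    GRing.eval (map psi e) (map_term iota t) = psi b.
Proof.
elim: t => //=.
- move=> i _; exists (nth 0 e i); case: (ltnP i (size e)) => h.
    by split=> [x|]; rewrite (nth_map 0).
  by rewrite !nth_default ?size_map // rmorph0; split=> // x; rewrite nth_default ?size_map.
- by move=> c _; exists (sa_cst false X c); split=> //; rewrite psi_R.
- move=> n _; exists n%:R; rewrite rmorph_nat; split=> // x.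
  by rewrite sa_ringMn sa_ring1.
- move=> t1 h1 t2 h2 /andP[/h1[p [pE ->]] /h2[q [qE ->]]].
  by exists (p + q); rewrite rmorphD; split=> // x; rewrite pE qE.
- by move=> t1 h1 /h1[p [pE ->]]; exists (- p); rewrite rmorphN; split=> // x; rewrite pE.
- move=> t1 h1 n /h1[p [pE ->]]; exists (p *+ n); rewrite rmorphMn; split=> // x.
  by rewrite pE sa_ringMn.
- move=> t1 h1 t2 h2 /andP[/h1[p [pE ->]] /h2[q [qE ->]]].
  by exists (p * q); rewrite rmorphM; split=> // x; rewrite pE qE.
- move=> t1 h1 n /h1[p [pE ->]]; exists (p ^+ n); rewrite rmorphXn; split=> // x.
  by rewrite pE sa_ringXn.
Qed.

(** The truth of an atom depends only on the sign of the difference of its two sides, and that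
    difference is what each atom contributes to the list. *)
Lemma formula_determine (e : seq S) (f : ord.formula R) : sign_formula f ->
  sgs_determine (fun v => ord.holds (map v e) f)
    (ord.holds (map psi e) (map_formula iota f)).
Proof.
have sgE (a : S) x : iota (Num.sg (a x)) = Num.sg (psi a) ->
   [/\ (a x == 0) = (psi a == 0), (a x < 0) = (psi a < 0) & (a x <= 0) = (psi a <= 0)].
  move=> E; rewrite -(sgr_eq0 (psi a)) -(sgr_lt0 (psi a)) -(sgr_le0 (psi a)) -E.
  by rewrite fmorph_eq0 sgr_eq0 -(rmorph0 iota) rmorph_ler rmorph_ltr sgr_lt0 sgr_le0.
rewrite /sign_formula; elim: f => //=.
- by move=> b _; exists [::].
- move=> t1 t2 /andP[/(eval_term_sa e)[p [pE ->]] /(eval_term_sa e)[q [qE ->]]].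
  exists [:: p - q] => x /(_ _ (mem_head _ _))/sgE[E _ _]; rewrite pE qE.
  by rewrite !(rwP eqP) -!(subr_eq0 _ (q x)) -(subr_eq0 _ (psi q)) -rmorphB -E.
- move=> t1 t2 /andP[/(eval_term_sa e)[p [pE ->]] /(eval_term_sa e)[q [qE ->]]].
  exists [:: p - q] => x /(_ _ (mem_head _ _))/sgE[_ E _]; rewrite pE qE.
  by rewrite -!(subr_lt0 (q x)) -(subr_lt0 (psi q)) -rmorphB -E.
- move=> t1 t2 /andP[/(eval_term_sa e)[p [pE ->]] /(eval_term_sa e)[q [qE ->]]].
  exists [:: p - q] => x /(_ _ (mem_head _ _))/sgE[_ _ E]; rewrite pE qE.
  by rewrite -!(subr_le0 (q x)) -(subr_le0 (psi q)) -rmorphB -E.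
- move=> f1 h1 f2 h2 /andP[/andP[q1 q2] /andP[r1 r2]].
  move: h1 h2; rewrite q1 q2 => /(_ r1) h1 /(_ r2) h2.
  by apply: sgs_determineI h1 h2 _ => v; tauto.
- move=> f1 h1 f2 h2 /andP[/andP[q1 q2] /andP[r1 r2]].
  move: h1 h2; rewrite q1 q2 => /(_ r1) h1 /(_ r2) h2.
  by apply: sgs_determineI h1 h2 _ => v; tauto.
- move=> f1 h1 f2 h2 /andP[/andP[q1 q2] /andP[r1 r2]].
  move: h1 h2; rewrite q1 q2 => /(_ r1) h1 /(_ r2) h2.
  by apply: sgs_determineI h1 h2 _ => v; tauto.
- move=> f1 h1 /h1 h2.
  by apply: (sgs_determineI (h2) (h2)) => v; tauto.
Qed.

Lemma formula_specialization (e : seq S) (f : ord.formula R) : sign_formula f ->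
  (forall x : X, ord.holds [seq a x | a : S <- e] f) ->
  ord.holds (map psi e) (map_formula iota f).
Proof.
move=> /(formula_determine e)[L LP] fX.
by have [x /LP[h _]] := sg_specialization L; apply: h.
Qed.

End Specialization.
End ClosedBounded.

(** * Extensions and cores *)

Section ExistentialClosure.
Variable R : rcfType.

(** Transfer speaks about parameters from [R], so points with coordinates in [F] must be bound by
    quantifiers before it applies. *)
Definition exists_from k n (f : ord.formula R) :=
  foldr ord.Exists f (seq.iota k n).

Lemma holds_exists_from n (s : seq R) f :
  ord.holds s (exists_from (size s) n f) <->
  exists2 e, size e = n & ord.holds (s ++ e) f.
Proof.
rewrite /exists_from; elim: n s => [|n IH] s /=.
  split=> [h|[[|//]]]; last by rewrite cats0.
  by exists [::]; rewrite ?cats0.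
have E x : set_nth 0 s (size s) x = rcons s x by elim: (s) => //= y s' ->.
split=> [[x]|[[|x e] //= [se] h]].
  rewrite E -(size_rcons s x) => /IH[e se]; rewrite cat_rcons => h.
  by exists (x :: e); rewrite //= se.
exists x; rewrite E -(size_rcons s x); apply/IH; exists e => //.
by rewrite cat_rcons.
Qed.

Lemma rformula_exists_from k n f : ord.rformula (exists_from k n f) = ord.rformula f.
Proof. by rewrite /exists_from; elim: n k => //= n IH k; apply: IH. Qed.

Lemma rterm_tinst s t : all (@GRing.rterm R) s -> GRing.rterm t ->
  GRing.rterm (tinst s t).
Proof.
move=> rs; elim: t => //=.
- move=> i _; case: (ltnP i (size s)) => h; last by rewrite nth_default.
  exact: all_nthP.
- by move=> ? h1 ? h2 /andP[/h1 -> /h2 ->].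
- by move=> ? h1 ? h2 /andP[/h1 -> /h2 ->].
Qed.

Lemma rformula_finst s f : all (@GRing.rterm R) s -> sign_formula f ->
  ord.rformula (finst s f).
Proof.
rewrite /sign_formula => rs; elim: f => //=;
  try by move=> t1 t2 /andP[r1 r2]; rewrite !rterm_tinst.
all: by move=> f1 h1 f2 h2 /andP[/andP[q1 q2] /andP[r1 r2]]; rewrite h1 ?h2 ?q1 ?q2.
Qed.

Lemma rterm_vars k l : all (@GRing.rterm R) (vars R k l).
Proof. by rewrite /vars all_map; apply/seq.allP. Qed.

End ExistentialClosure.

(** * Extended graphs and the value of a homomorphism at its core *)

Section Extension.
Variables (R F : rcfType) (iota : {rmorphism R -> F}).

Lemma map_formula_exists_from k n f :
  map_formula iota (exists_from k n f) = exists_from k n (map_formula iota f).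
Proof. by rewrite /exists_from; elim: n k => //= n IH k; rewrite IH. Qed.

Lemma map_term_tinst s t : map_term iota (tinst s t) =
  tinst (map (map_term iota) s) (map_term iota t).
Proof.
elim: t => //=; try by move=> *; congruence.
move=> i; case: (ltnP i (size s)) => h; first by rewrite (nth_map (GRing.NatConst R 0)).
by rewrite !nth_default ?size_map.
Qed.

Lemma map_formula_finst s f : ord.qf_form f -> map_formula iota (finst s f) =
  finst (map (map_term iota) s) (map_formula iota f).
Proof.
elim: f => //=; try by move=> *; rewrite !map_term_tinst.
- by move=> f h g k /andP[/h -> /k ->].
- by move=> f h g k /andP[/h -> /k ->].
- by move=> f h g k /andP[/h -> /k ->].
- by move=> f h /h ->.
Qed.

Lemma map_vars k l : map (map_term iota) (vars R k l) = vars F k l.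
Proof. by rewrite /vars -map_comp; apply: eq_map. Qed.

(** Two distinct values over [y] would witness a closed existential formula over [F]. By transfer it
    would hold over [R], where it contradicts that [a] is a function. The two memberships may come
    with different formulas [f] and [g], both defining the graph of [a]. *)
Lemma sa_ext_fgraph_functional n (M : set 'rV[R]_n) (a : M -> R)
    (y : 'rV[F]_n) (z z' : F) :
  sa_ext iota (Defs.fgraph a) (row_mx y (const_mx z)) ->
  sa_ext iota (Defs.fgraph a) (row_mx y (const_mx z')) -> z = z'.
Proof.
move=> [f [sf af fz]] [g [sg ag gz]].
(* The first [n] variables are the common point; variable [n] is the value used by [f], and variable
   [n.+1] the one used by [g]. *)
pose s1 K := vars K 0 n ++ vars K n 1; pose s2 K := vars K 0 n ++ vars K n.+1 1.
pose phi := ord.And (ord.And (finst (s1 R) f) (finst (s2 R) g))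
  (ord.Not (ord.Equal (GRing.Var R n) (GRing.Var R n.+1))).
have rphi : ord.rformula phi.
  by rewrite /= !rformula_finst ?all_cat ?rterm_vars.
have [qf qg] : ord.qf_form f /\ ord.qf_form g.
  by case/andP: sf => ->; case/andP: sg => ->.
have E (K : rcfType) (x : seq K) u v : size x = n -> [/\
    map (GRing.eval (x ++ [:: u; v])) (s1 K) = x ++ [:: u],
    map (GRing.eval (x ++ [:: u; v])) (s2 K) = x ++ [:: v],
    nth 0 (x ++ [:: u; v]) n = u & nth 0 (x ++ [:: u; v]) n.+1 = v].
  move=> sx; rewrite !map_cat (@eval_vars _ [::] x [:: u; v]) //.
  rewrite (@eval_vars _ x [:: u] [:: v]) // !nth_cat sx ltnn subnn.
  rewrite ltnNge leqnSn /= subSnn; split=> //; congr (_ ++ _).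
  by rewrite nth_cat sx ltnNge leqnSn /= subSnn.
apply: contrapT => zz'.
have : ord.holds (map iota [::])
    (map_formula iota (exists_from (size ([::] : seq R)) (n + 2) phi)).
  rewrite map_formula_exists_from; apply/holds_exists_from.
  exists (env y ++ [:: z; z']); first by rewrite size_cat size_env.
  have [E1 E2 E3 E4] := E F (env y) z z' (size_env y).
  rewrite /= E3 E4 !map_formula_finst // !map_cat !map_vars; split=> //.
  move: fz gz; rewrite /sat /= !env_row_mx !env_const -E1 -[in X in _ -> X -> _]E2.
  by split; apply/holds_finst; rewrite ?qf_form_map_formula // E1.
move/holds_map_formula; rewrite rformula_exists_from => /(_ rphi)/holds_exists_from[e].
move=> /split_size[x [uv [-> sx]]]; case: uv => [|u [|v []]] // _.
have [E1 E2 E3 E4] := E R x u v sx.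
rewrite /= E3 E4 => -[[/(holds_finst _ _ qf) fu /(holds_finst _ _ qg) gv]]; apply.
have fgr w h : Defs.fgraph a = sat h -> ord.holds (x ++ [:: w]) h ->
    exists x' : M, env (val x') = x /\ a x' = w.
  move=> ah hw; apply/(fgraphP a w sx); rewrite ah /sat /= rowofK //.
  by rewrite size_cat sx.
rewrite E1 in fu; rewrite E2 in gv.
have [x1 [x1x <-]] := fgr u f af fu; have [x2 [x2x <-]] := fgr v g ag gv.
by congr a; apply: env_inj; rewrite x1x x2x.
Qed.

Section Core.
Variables (m : nat) (X : sa_set R m).
Hypotheses (X_closed : closed X) (X_bounded : bounded_set X).
Variable psi : {rmorphism sa_ring false X -> F}.
Hypothesis psi_R : R_hom iota psi.
Local Notation coords := [seq sa_coord X i | i <- enum 'I_m].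

Lemma env_hom_core : env (hom_core psi) = map psi coords.
Proof. by rewrite /env -[RHS]map_comp; apply: eq_map => i /=; rewrite mxE. Qed.

Lemma coords_env (x : X) : [seq a x | a : sa_ring false X <- coords] = env (val x).
Proof. by rewrite -[LHS]map_comp. Qed.

Lemma hom_core_sa_ext : sa_ext iota X (hom_core psi).
Proof.
have [f sf Xf] := sa_carrierP X; exists f; split=> //.
rewrite /sat /= env_hom_core.
apply: (formula_specialization X_closed X_bounded psi_R sf) => x.
by rewrite coords_env; have := set_valP x; rewrite {1}Xf.
Qed.

Lemma fun_ext_hom_core (a : sa_ring false X) :
  fun_ext iota a (hom_core psi) = psi a.
Proof.
have aP : sa_ext iota (Defs.fgraph a) (row_mx (hom_core psi) (const_mx (psi a))).
  have [f sf af] := sa_ring_graph a; exists f; split=> //.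
  rewrite /sat /= env_row_mx env_const env_hom_core.
  (* The coordinate functions followed by [a] evaluate, at each point of X, to a point of the graph
     of [a]. *)
  rewrite -[[:: psi a]]/(map psi [:: a]) -map_cat.
  apply: (formula_specialization X_closed X_bounded psi_R sf) => x.
  rewrite map_cat coords_env.
  have : sat f (rowof (m + 1) (env (val x) ++ [:: a x])).
    by rewrite -af fgraphP ?size_env //; exists x.
  by rewrite /sat /= rowofK // size_cat size_env.
(* The default value of [xget] is excluded because [psi a] is a possible value; any value chosen
   equals it by functionality. *)
rewrite /fun_ext; case: xgetP => [z _ /= zP|/(_ _ aP)//].
exact: sa_ext_fgraph_functional zP aP.
Qed.

End Core.
End Extension.

(** * Extension of an injective homomorphism to the field of fractions *)

Section FractionLift.
Variables (D : idomainType) (K : fieldType) (h : {rmorphism D -> K}).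

Definition frac_lift (u : {fraction D}) : K := h (\n_(repr u)) / h (\d_(repr u)).

Hypothesis h_inj : injective h.

Let h_neq0 x : x != 0 -> h x != 0.
Proof. by rewrite -(rmorph0 h) (inj_eq h_inj). Qed.

Lemma frac_liftE a b : b != 0 -> frac_lift (a%:F / b%:F) = h a / h b.
Proof.
move=> b0; set u := a%:F / b%:F; have := frac_repr u.
have := denom_ratioP (repr u); rewrite /frac_lift; set c := \n__; set d := \d__.
move=> d0 /eqP; rewrite eqr_div ?tofrac_eq0 // -!tofracM tofrac_eq => /eqP abcd.
by apply/eqP; rewrite eqr_div ?h_neq0 // -!rmorphM abcd.
Qed.

Lemma fracP (u : {fraction D}) : exists a b, b != 0 /\ u = a%:F / b%:F.
Proof. by exists (\n_(repr u)), (\d_(repr u)); rewrite denom_ratioP -frac_repr. Qed.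

Lemma frac_lift_zmod : zmod_morphism frac_lift.
Proof.
move=> u v; have [a [b [b0 ->]]] := fracP u; have [c [d [d0 ->]]] := fracP v.
have -> : a%:F / b%:F - c%:F / d%:F = (a * d - c * b)%:F / (b * d)%:F.
  by rewrite -mulNr addf_div ?tofrac_eq0 // tofracB !tofracM mulNr.
rewrite !frac_liftE ?mulf_neq0 // -[- (h c / h d)]mulNr addf_div ?h_neq0 //.
by rewrite rmorphB !rmorphM mulNr.
Qed.

Lemma frac_lift_monoid : monoid_morphism frac_lift.
Proof.
split=> [|u v].
  have -> : (1 : {fraction D}) = 1%:F / 1%:F by rewrite tofrac1 divr1.
  by rewrite frac_liftE ?oner_neq0 // divff // h_neq0 ?oner_neq0.
have [a [b [b0 ->]]] := fracP u; have [c [d [d0 ->]]] := fracP v.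
rewrite mulf_div -!tofracM !frac_liftE ?mulf_neq0 //.
by rewrite !rmorphM mulf_div.
Qed.

(** The morphism structure rests on the injectivity of [h], hence it is packed for a given [h] under
    that hypothesis. *)
Lemma frac_lift_rmorphism :
  exists g : {rmorphism {fraction D} -> K}, g =1 frac_lift.
Proof.
pose A := GRing.isZmodMorphism.Build _ _ frac_lift frac_lift_zmod.
pose B := GRing.isMonoidMorphism.Build _ _ frac_lift frac_lift_monoid.
pose g : {rmorphism {fraction D} -> K} := HB.pack frac_lift A B.
by exists g.
Qed.

End FractionLift.

(** * Recovery of the homomorphism from its core *)

Theorem theorem4 (R F : rcfType) (iota : {rmorphism R -> F})
  (n : nat) (M : sa_set R n) (bd : bool)
  (phi : {rmorphism sa_ring bd M -> F}) (phi_R : R_hom iota phi)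
  (m : nat) (X : pseudo_compactification M m) (brimX : brimming X (ker_ideal phi)) :
  let p := ker_ideal phi in
  let jstar : {rmorphism sa_ring false X -> sa_ring bd M} := pullback X bd in
  let q := contracted_ideal jstar p in
  let psi : sa_ring false X -> F := phi \o jstar in
  let pt : 'rV[F]_m := hom_core psi in
  let inc := frac_map (quot_ind jstar p) in
  sa_ext iota X pt /\
  (exists psihat : {rmorphism {fraction prime_quot q} -> F},
    [/\ forall a1 a2 : sa_ring false X, a2 \notin q ->
          [/\ psi a2 != 0, fun_ext iota a2 pt != 0,
              psihat ((pq_proj q a1)%:F / (pq_proj q a2)%:F) = psi a1 / psi a2
            & psi a1 / psi a2 = fun_ext iota a1 pt / fun_ext iota a2 pt],
        forall (u : {fraction prime_quot q}) (b : prime_quot p),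
          inc u = b%:F -> psihat u = ker_ind phi b,
        forall a : prime_quot q, ker_ind phi (quot_ind jstar p a) = psihat a%:F,
        forall f : sa_ring bd M, ker_ind phi (pq_proj p f) = phi f
      & forall a : sa_ring false X, psihat (pq_proj q a)%:F = psi a]) /\
  (forall f : sa_ring bd M, exists a1 a2 : sa_ring false X,
    [/\ fun_ext iota a2 pt != 0, jstar a2 * f - jstar a1 \in p
      & phi f = fun_ext iota a1 pt / fun_ext iota a2 pt]).
Proof.
move=> p jstar q psi pt inc.
pose psi' : {rmorphism sa_ring false X -> F} := phi \o jstar.
have psi_R : R_hom iota psi'.
  by move=> c; rewrite -phi_R; congr (phi _); apply/val_inj.
have psiE (a : sa_ring false X) : fun_ext iota a pt = psi a.
  exact: (fun_ext_hom_core (@pc_closed _ _ _ _ X) (@pc_bounded _ _ _ _ X) psi_R).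
(* Membership in [q] unfolds to [psi a == 0]. *)
have psi_neq0 (a : sa_ring false X) : a \notin q -> psi a != 0 by [].
(* The composite of two injections, of A into the quotient by [p] and of that quotient into [F]; its
   lift to fractions is [psihat]. *)
pose h : {rmorphism prime_quot q -> F} := ker_ind phi \o quot_ind jstar p.
have h_proj a : h (pq_proj q a) = psi a.
  by rewrite /h /= quot_ind_proj ker_ind_proj.
have h_inj : injective h.
  by move=> u v /ker_ind_inj/quot_ind_inj.
have [psihat psihatE] := frac_lift_rmorphism h_inj.
have projq_neq0 a : a \notin q -> pq_proj q a != 0 by rewrite pq_proj_eq0.
have psihat_proj a : psihat (pq_proj q a)%:F = psi a.
  by rewrite -[_%:F]divr1 -tofrac1 psihatE frac_liftE ?oner_neq0 // rmorph1 divr1.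
have incE u b : inc u = b%:F -> psihat u = ker_ind phi b.
  have [x [y [y0 ->]]] := fracP u.
  have jy : quot_ind jstar p y != 0.
    by rewrite -(rmorph0 (quot_ind jstar p)) (inj_eq (@quot_ind_inj _ _ jstar p)).
  rewrite /inc frac_mapE //; last exact: quot_ind_inj.
  (* Cleared of denominators, [inc (x / y) = b] becomes an equation in the quotient by [p], to which
     the homomorphism induced by [phi] applies. *)
  move/(canRL (divfK _)); rewrite tofrac_eq0 => /(_ jy) /eqP.
  rewrite -tofracM tofrac_eq => /eqP xby.
  rewrite psihatE frac_liftE // /h /= xby rmorphM mulfK //.
  by rewrite -(rmorph0 (ker_ind phi)) (inj_eq (@ker_ind_inj _ _ phi)).
split.
  exact: (hom_core_sa_ext (@pc_closed _ _ _ _ X) (@pc_bounded _ _ _ _ X) psi_R).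
split.
  exists psihat; split=> //.
  - move=> a1 a2 a2q; rewrite !psiE psi_neq0 //; split=> //.
    by rewrite psihatE frac_liftE ?projq_neq0 // !h_proj.
  - move=> a; rewrite -[a]pq_reprK psihat_proj.
    by rewrite quot_ind_proj ker_ind_proj.
  - exact: ker_ind_proj.
(* Brimming enters here: the class of [f] is the image under [inc] of a fraction, and
   representatives of its numerator and denominator are the required [a1] and [a2]. *)
move=> f; have [inc' _ incK] := brimX.
have fE : inc (inc' (pq_proj p f)%:F) = (pq_proj p f)%:F by exact: incK.
have phif := incE _ _ fE; move: phif fE; rewrite ker_ind_proj.
have [x [y [y0 E]]] := fracP (inc' (pq_proj p f)%:F); rewrite E.
have [y' yE] : exists y', pq_proj q y' = y by exists (pq_repr y); exact: pq_reprK.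
have [x' xE] : exists x', pq_proj q x' = x by exists (pq_repr x); exact: pq_reprK.
have y'q : y' \notin q by rewrite -pq_proj_eq0 yE.
rewrite psihatE frac_liftE // -xE -yE !h_proj => phif _.
exists x', y'; rewrite !psiE psi_neq0 //; split=> //.
(* Since [p] is the kernel of [phi], membership follows from the formula for [phi f] by multiplying
   with the nonzero denominator. *)
apply/eqP; change (phi (jstar y' * f - jstar x') = 0).
by rewrite rmorphB rmorphM -phif mulrC divfK ?subrr // psi_neq0.
Qed.
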